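(* Let $S\subseteq[m]\times[n]$ be such that the $2$-way quasi-independence model $\mathcal{M}_S$ has rational maximum likelihood estimator (ML-degree $1$). Let $\bar{\mathcal{A}}_S$ be the multipartition matrix with blocks $\mathcal{B}_0,\dots,\mathcal{B}_h$ constructed from the poset $P_S$ of maximal cliques of $S$ (as defined in the context). Then $\bar{\mathcal{A}}_S$ is an iterated toric fiber product of linear ideals.
   Context: **Model.** $\mathcal{M}_S$ is the log-linear model of the $0/1$ matrix $\mathcal{A}_S$ with columns indexed by $S$ and rows $a_i$ ($i\in[m]$), $b_j$ ($j\in[n]$), where $a_i$ is the indicator vector of $\{(i,j')\in S\}$ and $b_j$ is the indicator vector of $\{(i',j)\in S\}$. Thus $\mathcal{M}_S$ is the set of positive probability vectors $p\in\mathbb{R}^S$ with $\log p\in\mathrm{rowspan}(\mathcal{A}_S)$. Its ML-degree is the number of complex critical points of $\sum u_s\log p_s$, for generic $u$, on the part of its Zariski closure with $\sum_s p_s=1$ and all $p_s\ne0$. ML-degree $1$ is equivalent to the MLE being rational. (Known fact: this holds iff the bipartite graph $\mathcal{G}_S$ on $[m]\sqcup[n]$ with edge set $S$ is doubly chordal bipartite, i.e. every cycle of length $\ge6$ has at least two chords.) Every $i\in[m]$ and every $j\in[n]$ is assumed to occur in some element of $S$. **Cliques.** A clique is a nonempty product $R\times C\subseteq S$ with $R\subseteq[m]$, $C\subseteq[n]$. Write $\mathrm{rows}(R\times C)=R$ and $\mathrm{cols}(R\times C)=C$. $\mathrm{Max}(S)$ is the set of containment-maximal cliques. $\mathrm{Int}(S)$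 is the set of containment-maximal elements among the nonempty intersections of two distinct elements of $\mathrm{Max}(S)$. $P_S$ is the poset on $\mathrm{Max}(S)$ with $D\le E$ iff $\mathrm{rows}(D)\subseteq\mathrm{rows}(E)$. It is known that, when the ML-degree is $1$, the Hasse diagram of $P_S$ is a tree (a forest if $\mathcal{G}_S$ is disconnected), and $D<E$ is a cover relation iff $D<E$ and $D\cap E\in\mathrm{Int}(S)$. Hence there is a function $\mathrm{Level}:\mathrm{Max}(S)\to\mathbb{Z}_{\ge1}$ with $\mathrm{Level}(E)=\mathrm{Level}(D)+1$ whenever $E$ covers $D$, normalized to have minimum $1$ (on each connected component). Let $h$ be the largest level. An element of $\mathrm{Int}(S)$ has level $r$ if it is $D\cap E$ with $E$ covering $D$, $\mathrm{Level}(D)=r$, $\mathrm{Level}(E)=r+1$. **Construction of $\bar{\mathcal{A}}_S$.** For $r\in\{0,\dots,h\}$: - $X_r$ is the set of level $r$ elements of $\mathrm{Int}(S)$ ($X_0=X_h=\emptyset$). - $R_0=[m]$, and for $r\ge1$, $R_r=R_{r-1}\setminus\{i : i\in\mathrm{rows}(D)\text{ for some }D\in\mathrm{Max}(S)\text{ of level }r\}$. - $C_0=\emptyset$, and for $r\ge1$, $C_r=C_{r-1}\cup\{j : j\text{ is a column of some level } r\text{ maximal clique but of no level } r+1\text{ maximal clique}\}$. $\mathcal{B}_r$ is the $0/1$ matrix with columns indexed by $S$ whose rows are the indicator vectors of the elements of $X_r$, the vectors $a_i$ for $i\in R_r$, and the vectors $b_j$ for $j\in C_r$. Each $\mathcal{B}_r$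 has exactly one $1$ in each column. $\bar{\mathcal{A}}_S$ is the vertical stack of $\mathcal{B}_0,\dots,\mathcal{B}_h$, and $\bar{\mathcal{A}}_S^{r}$ is the stack of $\mathcal{B}_0,\dots,\mathcal{B}_r$. **Toric fiber product of matrices.** The toric ideal of an integer matrix $X$ is $I_X=\langle x^u-x^v: u,v \text{ nonnegative integer vectors},\ u-v\in\ker_{\mathbb{Z}}X\rangle$. Let $X,Y$ be integer matrices (repeated columns allowed) whose columns are partitioned into classes $G_c$, respectively $H_c$, indexed by a common finite set. Give the variable of each column in $G_c$ (resp. $H_c$) the multidegree $e_c$, where the $e_c$ are standard basis vectors. If $I_X$ and $I_Y$ are homogeneous with respect to these multigradings, the toric fiber product of $X$ and $Y$ with respect to the partitions is the matrix whose columns, as a multiset, are all vertical concatenations of a column in $G_c$ with a column in $H_c$, over all $c$. **Iterated toric fiber product of linear ideals.** $\bar{\mathcal{A}}_S$ is an iterated toric fiber product of linear ideals if for each $r\in\{0,\dots,h-1\}$ there exist matrices $X$ and $Y$ such that the columns of $X$ are a sub-multiset of those of $\bar{\mathcal{A}}_S^{r}$, the columns of $Y$ are a sub-multiset of those of $\mathcal{B}_{r+1}$, and $\bar{\mathcal{A}}_S^{r+1}$ is a toric fiber product of $X$ and $Y$ with respect to some partition of the columns of $X$ into classes $G_c$ and some partition of the columns of $Y$ into classes $H_c$, indexed by a common finite set, such that $I_X$ and $I_Y$ are homogeneous with respect to the multigradings giving the variable of each column in $G_c$ (resp. $H_c$) the multidegree $e_c$. *)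

(* Defs.v *)
From mathcomp Require Import all_boot all_order all_algebra.
From mathcomp Require Import reals.
From mathcomp Require exp.
From mathcomp.real_closed Require Import complex.
From mathcomp Require Import mpoly.

Set Implicit Arguments.
Unset Strict Implicit.
Unset Printing Implicit Defensive.

Import Order.TTheory GRing.Theory Num.Theory.
Local Open Scope ring_scope.

(* Vectors and matrices with columns indexed by a finite set S of cells are
   indexed by 'I_#|S|; the cell of column s is enum_val s. *)

Section Indicators.

Variables (F : pzRingType) (m n : nat) (S : {set 'I_m * 'I_n}).

Definition indicator (D : {set 'I_m * 'I_n}) : 'rV[F]_#|S| :=
  \row_s (enum_val s \in D)%:R.

Definition row_indicator (i : 'I_m) : 'rV[F]_#|S| :=
  indicator [set s | s.1 == i].

Definition col_indicator (j : 'I_n) : 'rV[F]_#|S| :=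
  indicator [set s | s.2 == j].

Definition quasi_independence_mx : 'M[F]_(m + n, #|S|) :=
  col_mx (\matrix_(i < m) row_indicator i) (\matrix_(j < n) col_indicator j).

End Indicators.

Section ZariskiClosure.

Variables (C : fieldType) (k : nat).

Definition vanishing (V : 'rV[C]_k -> Prop) (f : {mpoly C[k]}) : Prop :=
  forall p, V p -> f.@[fun i => p 0 i] = 0.

Definition zariski_closure (V : 'rV[C]_k -> Prop) (p : 'rV[C]_k) : Prop :=
  forall f, vanishing V f -> f.@[fun i => p 0 i] = 0.

(* Zariski tangent space at p; V and its closure have the same ideal. *)
Definition zariski_tangent (V : 'rV[C]_k -> Prop) (p w : 'rV[C]_k) : Prop :=
  forall f, vanishing V f ->
    \sum_(i < k) (f^`M(i)).@[fun i' => p 0 i'] * w 0 i = 0.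

End ZariskiClosure.

Section MLDegree.

Variables (R : realType) (m n : nat) (S : {set 'I_m * 'I_n}).

Definition model (p : 'rV[R]_#|S|) : Prop :=
  [/\ forall s, 0 < p 0 s, \sum_s p 0 s = 1 &
      (map_mx (@exp.ln R) p <= quasi_independence_mx R S)%MS].

Definition complex_model (q : 'rV[R[i]]_#|S|) : Prop :=
  exists2 p, model p & q = map_mx (@real_complex R) p.

(* The gradient (u_s / p_s)_s of the log-likelihood annihilates the tangent
   space at p. The locus of the closure with nonzero coordinates is smooth (an
   orbit of a torus cut transversally by the hyperplane sum = 1), so no
   smoothness condition on p is needed. *)
Definition critical_point (u p : 'rV[R[i]]_#|S|) : Prop :=
  [/\ zariski_closure complex_model p, \sum_s p 0 s = 1,
      forall s, p 0 s != 0 &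
      forall w, zariski_tangent complex_model p w ->
        \sum_s u 0 s / p 0 s * w 0 s = 0].

(* "For generic u" means for u outside some proper hypersurface g = 0. *)
Definition has_ML_degree (d : nat) : Prop :=
  exists2 g : {mpoly R[i][#|S|]}, g != 0 &
    forall u : 'rV[R[i]]_#|S|, g.@[fun s => u 0 s] != 0 ->
      exists2 ps : seq 'rV[R[i]]_#|S|, uniq ps && (size ps == d) &
        forall p, p \in ps <-> critical_point u p.

End MLDegree.

Section Cliques.

Variables (m n : nat) (S : {set 'I_m * 'I_n}).

Implicit Types D E : {set 'I_m * 'I_n}.

Definition clique_rows D : {set 'I_m} := [set s.1 | s in D].
Definition clique_cols D : {set 'I_n} := [set s.2 | s in D].

Definition is_clique D : bool :=
  [&& D != set0, D == setX (clique_rows D) (clique_cols D) & D \subset S].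

Definition Max : {set {set 'I_m * 'I_n}} := [set D | maxset is_clique D].

Definition is_intersection I : bool :=
  (I != set0) &&
  [exists D in Max, exists E in Max, (D != E) && (I == D :&: E)].

Definition Int : {set {set 'I_m * 'I_n}} := [set I | maxset is_intersection I].

(* The strict order of P_S; it is antisymmetric on Max because a maximal clique
   is determined by its rows. *)
Definition clique_lt D E : bool :=
  (D != E) && (clique_rows D \subset clique_rows E).

Definition covers E D : bool :=
  [&& D \in Max, E \in Max, clique_lt D E &
      ~~ [exists F in Max, clique_lt D F && clique_lt F E]].

Definition hasse_edge D E : bool := covers D E || covers E D.

(* The normalization determines lev on Max; its values outside Max are never
   used. *)
Definition is_level (lev : {set 'I_m * 'I_n} -> nat) : Prop :=
  [/\ forall D E, covers E D -> lev E = (lev D).+1,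
      forall D, D \in Max -> (0 < lev D)%N &
      forall D, D \in Max ->
        exists E, [/\ E \in Max, connect hasse_edge D E & lev E = 1%N]].

Variable lev : {set 'I_m * 'I_n} -> nat.

Definition height : nat := \max_(D in Max) lev D.

Definition Xset (r : nat) : {set {set 'I_m * 'I_n}} :=
  [set I in Int | [exists D, exists E,
    [&& covers E D, lev D == r, lev E == r.+1 & I == D :&: E]]].

Fixpoint Rset (r : nat) : {set 'I_m} :=
  if r is r'.+1 then
    Rset r' :\: [set i | [exists D in Max, (lev D == r) && (i \in clique_rows D)]]
  else setT.

Definition level_cols (r : nat) : {set 'I_n} :=
  [set j | [exists D in Max, (lev D == r) && (j \in clique_cols D)]].

Fixpoint Cset (r : nat) : {set 'I_n} :=
  if r is r'.+1 then Cset r' :|: (level_cols r :\: level_cols r.+1) else set0.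

Definition block_size (r : nat) : nat :=
  (#|Xset r| + (#|Rset r| + #|Cset r|))%N.

Definition block (r : nat) : 'M[int]_(block_size r, #|S|) :=
  col_mx (\matrix_(i < #|Xset r|) indicator int S (enum_val i))
    (col_mx (\matrix_(i < #|Rset r|) row_indicator int S (enum_val i))
            (\matrix_(i < #|Cset r|) col_indicator int S (enum_val i))).

End Cliques.

Fixpoint stack_size (q : nat -> nat) (r : nat) : nat :=
  if r is r'.+1 then (stack_size q r' + q r)%N else q 0%N.

Fixpoint stack (q : nat -> nat) (k : nat) (B : forall r, 'M[int]_(q r, k))
    (r : nat) : 'M[int]_(stack_size q r, k) :=
  match r return 'M[int]_(stack_size q r, k) with
  | 0%N => B 0%N
  | r'.+1 => col_mx (stack B r') (B r'.+1)
  end.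

Section ToricIdeals.

Variables (K : fieldType) (k : nat).

Definition toric_binomial (a : nat) (X : 'M[int]_(a, k)) (f : {mpoly K[k]}) :
    Prop :=
  exists u v : 'X_{1..k},
    X *m (\col_j ((u j)%:Z - (v j)%:Z)) = 0 /\ f = 'X_[u] - 'X_[v].

Definition ideal_generated (P : {mpoly K[k]} -> Prop) (f : {mpoly K[k]}) :
    Prop :=
  exists2 s : seq ({mpoly K[k]} * {mpoly K[k]}),
    forall qg, qg \in s -> P qg.2 & f = \sum_(qg <- s) qg.1 * qg.2.

Definition toric_ideal (a : nat) (X : 'M[int]_(a, k)) : {mpoly K[k]} -> Prop :=
  ideal_generated (toric_binomial X).

(* The multigrading by N^T in which the i-th variable has degree e_(cls i). *)
Variables (T : finType) (cls : 'I_k -> T).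

Definition multidegree (u : 'X_{1..k}) : {ffun T -> nat} :=
  [ffun c => (\sum_(i | cls i == c) u i)%N].

Definition homogeneous_component (d : {ffun T -> nat}) (f : {mpoly K[k]}) :
    {mpoly K[k]} :=
  \sum_(u <- msupp f | multidegree u == d) f@_u *: 'X_[u].

Definition homogeneous_ideal (I : {mpoly K[k]} -> Prop) : Prop :=
  forall f d, I f -> I (homogeneous_component d f).

End ToricIdeals.

(* The columns as a multiset, i.e. a sequence up to perm_eq. *)
Definition columns (a k : nat) (X : 'M[int]_(a, k)) : seq 'cV[int]_a :=
  [seq col i X | i <- enum 'I_k].

Definition sub_multiset (U : eqType) (s t : seq U) : Prop :=
  forall x, (count_mem x s <= count_mem x t)%N.

(* The fibers of f and g are the classes G_c and H_c. *)
Definition is_toric_fiber_product (K : fieldType) (a b kx ky kz : nat)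
    (X : 'M[int]_(a, kx)) (Y : 'M[int]_(b, ky)) (T : finType)
    (f : 'I_kx -> T) (g : 'I_ky -> T) (Z : 'M[int]_(a + b, kz)) : Prop :=
  [/\ homogeneous_ideal f (toric_ideal (K:=K) X),
      homogeneous_ideal g (toric_ideal (K:=K) Y) &
      perm_eq (columns Z)
        [seq col_mx (col ij.1 X) (col ij.2 Y) |
           ij <- enum [set ij : 'I_kx * 'I_ky | f ij.1 == g ij.2]]].

Definition surj (A B : Type) (f : A -> B) : Prop := forall y, exists x, f x = y.

(* Surjectivity says that the classes of a partition are nonempty. *)
Definition iterated_toric_fiber_product (K : fieldType) (h k : nat)
    (q : nat -> nat) (B : forall r, 'M[int]_(q r, k)) : Prop :=
  forall r, (r < h)%N ->
    exists (kx ky : nat) (X : 'M[int]_(stack_size q r, kx))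
           (Y : 'M[int]_(q r.+1, ky)),
      [/\ sub_multiset (columns X) (columns (stack B r)),
          sub_multiset (columns Y) (columns (B r.+1)) &
          exists (T : finType) (f : 'I_kx -> T) (g : 'I_ky -> T),
            [/\ surj f, surj g &
                is_toric_fiber_product K X Y f g (stack B r.+1)]].

(* Main.v *)
(** Write D <= E for maximal cliques when rows(D) is contained in rows(E). The
    maximal cliques containing a cell (i, j) form the interval from the least
    maximal clique with row i to the greatest one with column j, and the theorem
    needs only that such an interval is a chain. Two incomparable cliques in it
    would give three rows and three columns on which S induces a hexagon with
    exactly one chord.

    A one-chord hexagon contradicts ML-degree 1. Its margins (r, c) can be chosen
    real and such that the two solutions p_ij = x_i y_j with these margins are
    nonreal. Attaching the remaining vertices of the bipartite graph one at a
    time, with small margins, a fixed point argument extends a nonreal solution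
    to all of S, depending in a Lipschitz way on the margins. So a nonempty open
    set of real data u has a nonreal critical point p, and the complex conjugate
    of p is a second one.

    Once intervals are chains, a level r + 1 maximal clique D is one class of the
    fiber product: on the cells of D, the column of B_0, ..., B_r depends only
    on the row of the cell, and the column of B_(r+1) only on its column. Every
    other class consists of the cells of one row, all of level > r + 1, or of
    one column, all of level < r + 1. The classes are unions of blocks of B_r and of
    B_(r+1), which makes the toric ideals homogeneous. *)

Require Import Defs.
From mathcomp Require Import boolp classical_sets reals.
From mathcomp Require exp.
From mathcomp Require Import all_boot all_order all_algebra.
From mathcomp.real_closed Require Import complex.
From mathcomp Require Import mpoly.
From mathcomp Require Import ring lra.

Set Implicit Arguments.
Unset Strict Implicit.
Unset Printing Implicit Defensive.

Import Order.TTheory GRing.Theory Num.Theory.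
Local Open Scope ring_scope.

(** * Locally Lipschitz functions *)

Local Notation normc := ComplexField.Normc.normc.

Section LocallyLipschitz.

Variables (R : realType) (T : finType).
Local Notation C := R[i].

Lemma normc_ge0 (x : C) : 0 <= normc x.
Proof. by case: x => a b /=; rewrite sqrtr_ge0. Qed.

Lemma normc0 : normc 0 = 0 :> R. Proof. exact: ComplexField.Normc.normc0. Qed.

Lemma normc_eq0 (x : C) : (normc x == 0) = (x == 0).
Proof.
by apply/eqP/eqP => [/ComplexField.Normc.eq0_normc|->] //; rewrite normc0.
Qed.

Lemma normcM (x y : C) : normc (x * y) = normc x * normc y.
Proof. exact: ComplexField.Normc.normcM. Qed.

Lemma normcV (x : C) : normc x^-1 = (normc x)^-1.
Proof. exact: ComplexField.Normc.normcV. Qed.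

Lemma normc_distC (x y : C) : normc (x - y) = normc (y - x).
Proof. by rewrite -normcN opprB. Qed.

Lemma normc_distD (y x z : C) : normc (x - z) <= normc (x - y) + normc (y - z).
Proof. by apply: le_trans (le_normcD _ _); rewrite addrA subrK. Qed.

Lemma normc_le_dist (x y : C) : normc x <= normc y + normc (x - y).
Proof. by apply: le_trans (le_normcD _ _); rewrite addrC subrK. Qed.

Lemma Re_le_normc (x : C) : `|complex.Re x| <= normc x.
Proof.
case: x => a b /=; rewrite -sqrtr_sqr ler_sqrt ?lerDl ?sqr_ge0 //.
by rewrite addr_ge0 ?sqr_ge0.
Qed.

Lemma Im_le_normc (x : C) : `|complex.Im x| <= normc x.
Proof.
case: x => a b /=; rewrite -sqrtr_sqr ler_sqrt ?lerDr ?sqr_ge0 //.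
by rewrite addr_ge0 ?sqr_ge0.
Qed.

Lemma normc_le_ReIm (x : C) : normc x <= `|complex.Re x| + `|complex.Im x|.
Proof.
case: x => a b /=; rewrite -[leRHS]ger0_norm ?addr_ge0 // -sqrtr_sqr.
rewrite ler_sqrt ?sqr_ge0 // sqrrD !real_normK ?num_real //.
by rewrite lerD2r lerDl mulrn_wge0 // mulr_ge0.
Qed.

Definition cball (b0 : T -> C) (e : R) (b : T -> C) : Prop :=
  forall k, normc (b k - b0 k) <= e.

Definition near (b0 : T -> C) (P : (T -> C) -> Prop) : Prop :=
  exists2 e : R, 0 < e & forall b, cball b0 e b -> P b.

Definition lipschitz_on (b0 : T -> C) (e L : R) (f : (T -> C) -> C) : Prop :=
  forall b b' d, 0 <= d ->
    cball b0 e b -> cball b0 e b' -> cball b d b' ->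
    normc (f b' - f b) <= L * d.

Definition lipschitz_at (b0 : T -> C) (f : (T -> C) -> C) : Prop :=
  exists e L : R, [/\ 0 < e, 0 < L & lipschitz_on b0 e L f].

Implicit Types (b c : T -> C) (f g : (T -> C) -> C).

Lemma cball_center b e : 0 <= e -> cball b e b.
Proof. by move=> e0 k; rewrite subrr normc0. Qed.

Lemma cballW b0 e e' b : e <= e' -> cball b0 e b -> cball b0 e' b.
Proof. by move=> ee' H k; apply: le_trans (H k) _. Qed.

Lemma cball_trans c b0 e e' b :
  cball b0 e c -> cball c e' b -> cball b0 (e + e') b.
Proof.
move=> H H' k; apply: le_trans (normc_distD (c k) _ _) _.
by rewrite addrC lerD.
Qed.

Lemma near_mono b0 (P Q : (T -> C) -> Prop) :
  (forall b, P b -> Q b) -> near b0 P -> near b0 Q.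
Proof. by move=> PQ [e e0 H]; exists e => // b /H /PQ. Qed.

Lemma near_and b0 (P Q : (T -> C) -> Prop) :
  near b0 P -> near b0 Q -> near b0 (fun b => P b /\ Q b).
Proof.
move=> [e e0 H] [e' e'0 H']; exists (Num.min e e'); first by rewrite lt_min e0.
by move=> b Hb; split; [apply: H | apply: H']; apply: cballW Hb;
  rewrite ge_min lexx ?orbT.
Qed.

Lemma nearT b0 (P : (T -> C) -> Prop) : (forall b, P b) -> near b0 P.
Proof. by move=> HP; exists 1. Qed.

Lemma near_center b0 (P : (T -> C) -> Prop) : near b0 P -> P b0.
Proof. by case=> e e0; apply; apply/cball_center/ltW. Qed.

Lemma near_all (I : finType) b0 (P : I -> (T -> C) -> Prop) :
  (forall i, near b0 (P i)) -> near b0 (fun b => forall i, P i b).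
Proof.
move=> H; suff: near b0 (fun b => forall i, i \in enum I -> P i b).
  by apply: near_mono => b Hb i; apply: Hb; rewrite mem_enum.
elim: (enum I) => [|i s IHs]; first exact: nearT.
apply: near_mono (near_and (H i) IHs) => b [Pi Ps] k.
by rewrite in_cons => /predU1P[-> //|]; apply: Ps.
Qed.

Lemma near_near b0 (P : (T -> C) -> Prop) :
  near b0 P -> near b0 (fun c => near c P).
Proof.
move=> [e e0 H]; have e20 : 0 < e / 2 by rewrite divr_gt0.
exists (e / 2) => // c Hc; exists (e / 2) => // b Hb; apply: H.
by rewrite [e]splitr; apply: cball_trans Hc Hb.
Qed.

Lemma lipschitz_onW b0 e e' L f :
  e' <= e -> lipschitz_on b0 e L f -> lipschitz_on b0 e' L f.
Proof.
by move=> ee' H b b' d d0 Hb Hb'; apply: H => //; apply: cballW ee' _.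
Qed.

Lemma lipschitz_pair b0 f g :
  lipschitz_at b0 f -> lipschitz_at b0 g -> exists e L M : R,
    [/\ 0 < e, 0 < L, 0 < M & lipschitz_on b0 e L f /\ lipschitz_on b0 e M g].
Proof.
move=> [e [L [e0 L0 Hf]]] [e' [M [e'0 M0 Hg]]].
exists (Num.min e e'), L, M; rewrite lt_min e0 e'0; split => //.
by split; [apply: lipschitz_onW Hf | apply: lipschitz_onW Hg];
  rewrite ge_min lexx ?orbT.
Qed.

Lemma lipschitz_cst b0 (z : C) : lipschitz_at b0 (fun=> z).
Proof.
by exists 1, 1; split=> // b b' d d0 _ _ _; rewrite subrr normc0 mul1r.
Qed.

Lemma lipschitz_proj b0 k : lipschitz_at b0 (fun b => b k).
Proof. by exists 1, 1; split=> // b b' d d0 _ _ /(_ k); rewrite mul1r. Qed.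

Lemma lipschitzD b0 f g : lipschitz_at b0 f -> lipschitz_at b0 g ->
  lipschitz_at b0 (fun b => f b + g b).
Proof.
move=> Hf Hg; have [e [L [M [e0 L0 M0 [{}Hf {}Hg]]]]] := lipschitz_pair Hf Hg.
exists e, (L + M); split=> //; first exact: addr_gt0.
move=> b b' d d0 Hb Hb' Hd; rewrite opprD addrACA.
by apply: le_trans (le_normcD _ _) _; rewrite mulrDl lerD ?Hf ?Hg.
Qed.

Lemma lipschitzN b0 f : lipschitz_at b0 f -> lipschitz_at b0 (fun b => - f b).
Proof.
move=> [e [L [e0 L0 Hf]]]; exists e, L; split=> // b b' d d0 Hb Hb' Hd.
by rewrite -opprD normcN Hf.
Qed.

Lemma lipschitzB b0 f g : lipschitz_at b0 f -> lipschitz_at b0 g ->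
  lipschitz_at b0 (fun b => f b - g b).
Proof. by move=> Hf Hg; apply/lipschitzD/lipschitzN. Qed.

Lemma lipschitz_sum (I : Type) (r : seq I) (P : pred I) b0
    (F : I -> (T -> C) -> C) :
  (forall i, P i -> lipschitz_at b0 (F i)) ->
  lipschitz_at b0 (fun b => \sum_(i <- r | P i) F i b).
Proof.
move=> H; elim: r => [|i r IHr].
  under eq_fun => b do rewrite big_nil; exact: lipschitz_cst.
under eq_fun => b do rewrite big_cons.
by case Pi: (P i) => //; apply: lipschitzD => //; apply: H.
Qed.

Lemma lipschitz_close b0 f eta : lipschitz_at b0 f -> 0 < eta ->
  near b0 (fun b => normc (f b - f b0) <= eta).
Proof.
move=> [e [L [e0 L0 Hf]]] eta0.
exists (Num.min e (eta / L)); first by rewrite lt_min e0 divr_gt0.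
move=> b Hb; have d0 : 0 <= eta / L by rewrite ltW // divr_gt0.
have := Hf b0 b (eta / L) d0; rewrite [L * _]mulrC divfK ?gt_eqF //; apply.
- exact/cball_center/ltW.
- by apply: cballW Hb; rewrite ge_min lexx.
- by apply: cballW Hb; rewrite ge_min lexx orbT.
Qed.

Lemma lipschitz_bounded b0 f : lipschitz_at b0 f ->
  near b0 (fun b => normc (f b) <= normc (f b0) + 1).
Proof.
move=> Hf; apply: near_mono (lipschitz_close Hf ltr01) => b Hb.
by apply: le_trans (normc_le_dist _ (f b0)) _; rewrite lerD2l.
Qed.

Lemma lipschitz_near b0 f : lipschitz_at b0 f -> near b0 (lipschitz_at^~ f).
Proof.
move=> [e [L [e0 L0 Hf]]]; have e20 : 0 < e / 2 by rewrite divr_gt0.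
exists (e / 2) => // c Hc; exists (e / 2), L; split=> // b b' d d0 Hb Hb' Hd.
by apply: Hf => //; rewrite [e]splitr; apply: cball_trans Hc _.
Qed.

Lemma lipschitz_near_neq0 b0 f : lipschitz_at b0 f -> f b0 != 0 ->
  near b0 (fun b => f b != 0).
Proof.
move=> Hf f0; have n0 : 0 < normc (f b0) by rewrite lt0r normc_eq0 f0 normc_ge0.
have n20 : 0 < normc (f b0) / 2 by rewrite divr_gt0.
apply: near_mono (lipschitz_close Hf n20) => b Hb; apply/eqP => fb0.
by move: Hb; rewrite fb0 sub0r normcN; lra.
Qed.

Lemma lipschitz_near_nonreal b0 f : lipschitz_at b0 f -> complex.Im (f b0) != 0 ->
  near b0 (fun b => complex.Im (f b) != 0).
Proof.
move=> Hf f0; have n0 : 0 < `|complex.Im (f b0)| by rewrite normr_gt0.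
have n20 : 0 < `|complex.Im (f b0)| / 2 by rewrite divr_gt0.
apply: near_mono (lipschitz_close Hf n20) => b Hb; apply/eqP => fb0.
have := le_trans (Im_le_normc _) Hb.
have -> : complex.Im (f b - f b0) = complex.Im (f b) - complex.Im (f b0).
  by case: (f b) (f b0) => [? ?] [? ?].
by rewrite fb0 sub0r normrN; lra.
Qed.

Lemma lipschitzM b0 f g : lipschitz_at b0 f -> lipschitz_at b0 g ->
  lipschitz_at b0 (fun b => f b * g b).
Proof.
move=> Hf Hg; have [e1 e10 Bf] := lipschitz_bounded Hf.
have [e2 e20 Bg] := lipschitz_bounded Hg.
have [e [L [M [e0 L0 M0 [{}Hf {}Hg]]]]] := lipschitz_pair Hf Hg.
set A := normc (f b0) + 1 in Bf; set B := normc (g b0) + 1 in Bg.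
have A0 : 0 < A by rewrite ltr_wpDl ?normc_ge0.
have B0 : 0 < B by rewrite ltr_wpDl ?normc_ge0.
exists (Num.min e (Num.min e1 e2)), (L * B + A * M).
rewrite !lt_min e0 e10 e20; split=> //; first by rewrite addr_gt0 ?mulr_gt0.
move=> b b' d d0 Hb Hb' Hd.
have W1 : Num.min e (Num.min e1 e2) <= e by rewrite ge_min lexx.
have W2 : Num.min e (Num.min e1 e2) <= e1 by rewrite !ge_min lexx orbT.
have W3 : Num.min e (Num.min e1 e2) <= e2 by rewrite !ge_min lexx !orbT.
have -> : f b' * g b' - f b * g b = (f b' - f b) * g b' + f b * (g b' - g b).
  by rewrite mulrBl mulrBr addrA subrK.
apply: le_trans (le_normcD _ _) _; rewrite !normcM mulrDl; apply: lerD.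
  rewrite mulrAC ler_pM ?normc_ge0 //.
    by apply: Hf => //; [apply: cballW Hb | apply: cballW Hb'].
  by apply: Bg; apply: cballW Hb'.
rewrite -mulrA ler_pM ?normc_ge0 //.
  by apply: Bf; apply: cballW Hb.
by apply: Hg => //; [apply: cballW Hb | apply: cballW Hb'].
Qed.

Lemma lipschitzV b0 f : lipschitz_at b0 f -> f b0 != 0 ->
  lipschitz_at b0 (fun b => (f b)^-1).
Proof.
move=> Hf f0; have n0 : 0 < normc (f b0) by rewrite lt0r normc_eq0 f0 normc_ge0.
set A := normc (f b0) / 2; have A0 : 0 < A by rewrite divr_gt0.
have [e1 e10 Cf] := lipschitz_close Hf A0.
have [e [L [e0 L0 {}Hf]]] := Hf.
have fA b : cball b0 e1 b -> A <= normc (f b).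
  move=> /Cf Hb; have := normc_le_dist (f b0) (f b); rewrite normc_distC.
  by move: Hb; rewrite /A; lra.
have AA0 : 0 < A * A by apply: mulr_gt0.
exists (Num.min e e1), (L / (A * A)).
rewrite lt_min e0 e10; split=> //; first by apply: divr_gt0.
move=> b b' d d0 Hb Hb' Hd.
have fbA : A <= normc (f b) by apply: fA; apply: cballW Hb; rewrite ge_min lexx orbT.
have fbA' : A <= normc (f b') by apply: fA; apply: cballW Hb'; rewrite ge_min lexx orbT.
have fb0 : f b != 0 by rewrite -normc_eq0 gt_eqF // (lt_le_trans A0).
have fb0' : f b' != 0 by rewrite -normc_eq0 gt_eqF // (lt_le_trans A0).
have -> : (f b')^-1 - (f b)^-1 = (f b - f b') * ((f b') * (f b))^-1.
  by field; rewrite fb0 fb0'.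
rewrite normcM normcV mulrAC; apply: ler_pM; rewrite ?normc_ge0 //.
- by rewrite invr_ge0 normcM mulr_ge0 ?normc_ge0.
- rewrite normc_distC; apply: Hf => //.
    by apply: cballW Hb; rewrite ge_min lexx.
  by apply: cballW Hb'; rewrite ge_min lexx.
- have AA : A * A <= normc (f b' * f b) by rewrite normcM ler_pM // ltW.
  by rewrite lef_pV2 // posrE (lt_le_trans AA0).
Qed.

Lemma lipschitz_common b0 (I : finType) (F : I -> (T -> C) -> C) :
  (forall i, lipschitz_at b0 (F i)) ->
  exists e L : R, [/\ 0 < e, 0 < L & forall i, lipschitz_on b0 e L (F i)].
Proof.
move=> H; suff [e [L [e0 L0 HL]]] : exists e L : R, [/\ 0 < e, 0 < L &
    forall i, i \in enum I -> lipschitz_on b0 e L (F i)].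
  by exists e, L; split=> // i; apply: HL; rewrite mem_enum.
elim: (enum I) => [|i s [e [L [e0 L0 HL]]]]; first by exists 1, 1.
have [e' [L' [e'0 L'0 HL']]] := H i.
exists (Num.min e e'), (L + L'); rewrite lt_min e0 e'0 addr_gt0 //.
split=> // k; rewrite in_cons => ks b b' d d0 Hb Hb' Hd.
have W : Num.min e e' <= e by rewrite ge_min lexx.
have W' : Num.min e e' <= e' by rewrite ge_min lexx orbT.
rewrite mulrDl; have [ki|ks'] := predU1P ks.
  rewrite ki; apply: ler_wpDl; first by rewrite mulr_ge0 // ltW.
  by apply: HL' => //; [apply: cballW Hb | apply: cballW Hb'].
apply: ler_wpDr; first by rewrite mulr_ge0 // ltW.
by apply: HL => //; [apply: cballW Hb | apply: cballW Hb'].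
Qed.

Lemma lipschitz_comp b0 f (beta : T -> (T -> C) -> C) :
  (forall k, lipschitz_at b0 (beta k)) -> lipschitz_at (beta^~ b0) f ->
  lipschitz_at b0 (fun b => f (beta^~ b)).
Proof.
move=> Hbeta [e [L [e0 L0 Hf]]].
have [e1 e10 Hc] := near_all (fun k => lipschitz_close (Hbeta k) e0).
have [e2 [M [e20 M0 HM]]] := lipschitz_common Hbeta.
exists (Num.min e1 e2), (L * M); rewrite lt_min e10 e20 mulr_gt0 //.
split=> // b b' d d0 Hb Hb' Hd.
have W1 : Num.min e1 e2 <= e1 by rewrite ge_min lexx.
have W2 : Num.min e1 e2 <= e2 by rewrite ge_min lexx orbT.
rewrite -mulrA; apply: Hf.
- by rewrite mulr_ge0 // ltW.
- by move=> k; apply: Hc; apply: cballW Hb.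
- by move=> k; apply: Hc; apply: cballW Hb'.
- by move=> k; apply: HM => //; [apply: cballW Hb | apply: cballW Hb'].
Qed.

End LocallyLipschitz.

Section FixedPoint.

Variables (R : realType) (T : finType).
Local Notation C := R[i].
Implicit Types (b c : T -> C).

Lemma le0_geometric (x K : R) : (forall n, x <= K / 2 ^+ n) -> x <= 0.
Proof.
move=> H; rewrite leNgt; apply/negP => x0.
have K0 : 0 < K by have := H 0%N; rewrite expr0 divr1; apply: lt_le_trans.
have /archi_boundP : 0 <= K / x by rewrite divr_ge0 // ltW.
set n := Num.bound _ => Kn.
have n2 : n%:R <= 2 ^+ n :> R by rewrite -natrX ler_nat ltnW // ltn_expl.
have p2 : 0 < 2 ^+ n :> R by rewrite exprn_gt0.
have := H n; rewrite ler_pdivlMr //.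
have := lt_le_trans Kn n2; rewrite ltr_pdivrMr // mulrC => h1 h2.
by have := lt_le_trans h1 h2; rewrite ltxx.
Qed.

Lemma geometric_cvg_real (u : nat -> R) (K : R) :
  (forall n, `|u n.+1 - u n| <= K / 2 ^+ n) ->
  exists l, forall n, `|l - u n| <= 2 * K / 2 ^+ n.
Proof.
move=> H; set w := fun n => 2 * K / 2 ^+ n.
have K0 : 0 <= K.
  by have := H 0%N; rewrite expr0 divr1; apply: le_trans (normr_ge0 _).
have w0 n : 0 <= w n by apply: divr_ge0; [apply: mulr_ge0 | apply: exprn_ge0].
have wS n : w n - w n.+1 = K / 2 ^+ n.
  have p2 : 2 ^+ n != 0 :> R by rewrite gt_eqF ?exprn_gt0.
  by rewrite /w exprS; field.
have lo n k : u n - w n <= u (n + k)%N - w (n + k)%N.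
  elim: k => [|k IHk]; first by rewrite addn0.
  apply: le_trans IHk _; rewrite addnS; have := H (n + k)%N; rewrite -wS.
  by rewrite ler_norml => /andP[]; lra.
have up n k : u (n + k)%N + w (n + k)%N <= u n + w n.
  elim: k => [|k IHk]; first by rewrite addn0.
  apply: le_trans IHk; rewrite addnS; have := H (n + k)%N; rewrite -wS.
  by rewrite ler_norml => /andP[]; lra.
have lu n m : u n - w n <= u m + w m.
  have /orP[/subnKC <-|/subnKC <-] := leq_total n m.
    by apply: le_trans (lo n _) _; have := w0 (n + (m - n))%N; lra.
  by apply: le_trans (up m (n - m)%N); have := w0 (m + (n - m))%N; lra.
pose E := [set x | exists n, x = u n - w n]%classic.
have Eub m : ubound E (u m + w m) by move=> _ [n ->].
have E0 : (E !=set0)%classic by exists (u 0%N - w 0%N); exists 0%N.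
exists (sup E) => n; rewrite ler_norml; apply/andP; split.
  have : u n - w n <= sup E.
    by apply: ub_le_sup; [exists (u 0%N + w 0%N) | exists n].
  by rewrite /w; lra.
have : sup E <= u n + w n by apply: ge_sup.
by rewrite /w; lra.
Qed.

Lemma geometric_cvg_complex (u : nat -> C) (K : R) :
  (forall n, normc (u n.+1 - u n) <= K / 2 ^+ n) ->
  exists l, forall n, normc (l - u n) <= 4 * K / 2 ^+ n.
Proof.
move=> H.
have ReB (x y : C) : complex.Re (x - y) = complex.Re x - complex.Re y.
  by case: x y => [? ?] [? ?].
have ImB (x y : C) : complex.Im (x - y) = complex.Im x - complex.Im y.
  by case: x y => [? ?] [? ?].
have [n|a Ha] := @geometric_cvg_real (fun n => complex.Re (u n)) K.
  by rewrite -ReB; apply: le_trans (Re_le_normc _) (H n).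
have [n|b Hb] := @geometric_cvg_real (fun n => complex.Im (u n)) K.
  by rewrite -ImB; apply: le_trans (Im_le_normc _) (H n).
exists (Complex a b) => n; apply: le_trans (normc_le_ReIm _) _.
rewrite ReB ImB /=; have := lerD (Ha n) (Hb n).
by rewrite -mulrDl -mulrDl -natrD.
Qed.

Lemma contraction_fixpoint (F : (T -> C) -> T -> C) b0 (e : R) : 0 < e ->
  (forall b, cball b0 e b -> cball b0 e (F b)) ->
  (forall b b' d, 0 <= d -> cball b0 e b -> cball b0 e b' -> cball b d b' ->
     cball (F b) (d / 2) (F b')) ->
  exists2 b, cball b0 e b & forall k, F b k = b k.
Proof.
move=> e0 Fe Fc; pose u n := iter n F b0.
have ub n : cball b0 e (u n).
  by elim: n => [|n IHn] /=; [apply/cball_center/ltW | apply: Fe].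
have us n : cball (u n) (e / 2 ^+ n) (u n.+1).
  elim: n => [|n IHn]; first by rewrite expr0 divr1; apply: (ub 1%N).
  have -> : e / 2 ^+ n.+1 = e / 2 ^+ n / 2.
    have p2 : 2 ^+ n != 0 :> R by rewrite gt_eqF ?exprn_gt0.
    by rewrite exprS; field.
  by apply: Fc (ub _) (ub _) IHn; apply: divr_ge0; [apply: ltW | apply: exprn_ge0].
have /choice[l Hl] : forall k, exists z, forall n,
    normc (z - u n k) <= 4 * e / 2 ^+ n.
  by move=> k; apply: geometric_cvg_complex => n; apply: us.
have le_lim (x y K : R) : (forall n, x <= y + K / 2 ^+ n) -> x <= y.
  move=> H; rewrite -subr_le0; apply: (@le0_geometric _ K) => n.
  by rewrite lerBlDl.
have bl : cball b0 e l.
  move=> k; apply: (@le_lim _ _ (4 * e)) => n.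
  apply: le_trans (normc_distD (u n k) _ _) _.
  by rewrite addrC; apply: lerD; [apply: ub | apply: Hl].
exists l => // k; apply/eqP; rewrite -subr_eq0 -normc_eq0.
rewrite eq_le normc_ge0 andbT; apply: (@le0_geometric _ (4 * e)) => n.
apply: le_trans (normc_distD (u n.+1 k) _ _) _.
have p2 : 0 < 2 ^+ n :> R by rewrite exprn_gt0.
have q0 : 0 <= 4 * e / 2 ^+ n.
  by apply: divr_ge0 (ltW p2); apply: mulr_ge0 (ltW e0).
have h1 : normc (F l k - u n.+1 k) <= 4 * e / 2 ^+ n / 2.
  by apply: (Fc (u n) l) => // k'.
have h2 : normc (u n.+1 k - l k) <= 4 * e / 2 ^+ n / 2.
  rewrite normc_distC; apply: le_trans (Hl k n.+1) _.
  rewrite le_eqVlt; apply/orP; left; apply/eqP; rewrite exprS; field.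
  by rewrite gt_eqF.
by apply: le_trans (lerD h1 h2) _; rewrite -splitr.
Qed.

(* The parameter is the coordinate w of b, which vanishes at the new centre:
   there the perturbation is switched off. *)
Lemma small_perturbation (b0 : T -> C) (w : T) (phi : T -> (T -> C) -> C) :
  (forall k, lipschitz_at b0 (phi k)) ->
  let c := fun k => if k == w then 0 else b0 k in
  exists beta : T -> (T -> C) -> C,
    [/\ forall k, lipschitz_at c (beta k), forall k, beta k c = b0 k &
        near c (fun b => forall k, beta k b =
          if k == w then b0 w else b k - b w * phi k (beta^~ b))].
Proof.
move=> Hphi c.
have [e [L [e0 L0 HL]]] := lipschitz_common Hphi.
have [e1 e10 HM] := near_all (fun k => lipschitz_bounded (Hphi k)).
pose M := \sum_k (normc (phi k b0) + 1).
have M0 : 0 <= M by apply: sumr_ge0 => k _; rewrite addr_ge0 ?normc_ge0.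
have {}HM b k : cball b0 e1 b -> normc (phi k b) <= M.
  move=> /HM /(_ k) /le_trans; apply; rewrite /M (bigD1 k) //= lerDl.
  by apply: sumr_ge0 => k' _; rewrite addr_ge0 ?normc_ge0.
pose E := Num.min e e1.
have E0 : 0 < E by rewrite lt_min e0 e10.
have Ee : E <= e by rewrite ge_min lexx.
have Ee1 : E <= e1 by rewrite ge_min lexx orbT.
pose d := Num.min (E / (1 + M)) (1 / (2 * L)).
have M10 : 0 < 1 + M by rewrite ltr_pwDl.
have d0 : 0 < d by rewrite lt_min !divr_gt0 // mulr_gt0.
have dM : d + d * M <= E.
  have : d <= E / (1 + M) by rewrite ge_min lexx.
  by rewrite ler_pdivlMr // mulrDr mulr1.
have dL : d * L <= 1 / 2.
  have : d <= 1 / (2 * L) by rewrite ge_min lexx orbT.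
  rewrite ler_pdivlMr ?mulr_gt0 // => H.
  by rewrite ler_pdivlMr // -mulrA [L * _]mulrC.
pose F b v k := if k == w then b0 w else b k - b w * phi k v.
have bw b : cball c d b -> normc (b w) <= d.
  by move=> /(_ w); rewrite /c eqxx subr0.
have bk b k : k != w -> cball c d b -> normc (b k - b0 k) <= d.
  by move=> kw /(_ k); rewrite /c (negbTE kw).
have fix_ex b : exists v, cball c d b ->
    cball b0 E v /\ forall k, v k = F b v k.
  have [Hb|nHb] := pselect (cball c d b); last by exists b0.
  have [||v Ev Fv] := @contraction_fixpoint (F b) b0 E E0.
  - move=> v Hv k; rewrite /F; case: eqVneq => [->|kw].
      by rewrite subrr normc0 ltW.
    rewrite addrAC; apply: le_trans (le_normcD _ _) _; apply: le_trans dM.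
    rewrite normcN normcM lerD ?bk // ler_pM ?normc_ge0 ?bw //.
    by apply: HM; apply: cballW Hv.
  - move=> v v' t t0 Hv Hv' Ht k; rewrite /F; case: eqVneq => [_|kw].
      by rewrite subrr normc0 divr_ge0.
    have -> : b k - b w * phi k v' - (b k - b w * phi k v) =
      b w * - (phi k v' - phi k v) by ring.
    rewrite normcM normcN.
    apply: (@le_trans _ _ (d * (L * t))).
      rewrite ler_pM ?normc_ge0 ?bw //; apply: HL => //.
        by apply: cballW Hv.
      by apply: cballW Hv'.
    by rewrite mulrA [leRHS]mulrC ler_wpM2r //; move: dL; rewrite div1r.
  by exists v => _; split.
have [sol Hsol] := choice fix_ex.
exists (fun k b => sol b k).
have cc : cball c d c by apply/cball_center/ltW.
split.
- move=> k; exists d, (2 * (1 + M)); split=> //; first by rewrite mulr_gt0.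
  move=> b b' t t0 Hb Hb' Ht; have [Hv Ev] := Hsol b Hb.
  have [Hv' Ev'] := Hsol b' Hb'.
  have [j _ Hj] := @arg_maxP _ R T k xpredT
    (fun k => normc (sol b' k - sol b k)) isT.
  suff H : normc (sol b' j - sol b j) <= 2 * (1 + M) * t.
    by apply: le_trans H; apply: Hj.
  have D0 := normc_ge0 (sol b' j - sol b j).
  set D := normc _ in D0 Hj *.
  suff : D <= t + (t * M + d * (L * D)).
    have : d * L * D <= 1 / 2 * D by rewrite ler_wpM2r.
    by rewrite mulrA; nra.
  rewrite {1}/D Ev Ev' /F; case: eqVneq => [_|jw].
    by rewrite subrr normc0 !(addr_ge0, mulr_ge0) // ltW.
  have -> : b' j - b' w * phi j (sol b') - (b j - b w * phi j (sol b)) =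
    (b' j - b j) + ((b' w - b w) * - phi j (sol b') +
                    b w * - (phi j (sol b') - phi j (sol b))).
    by ring.
  apply: le_trans (le_normcD _ _) _; apply: lerD; first exact: Ht.
  apply: le_trans (le_normcD _ _) _; rewrite !normcM !normcN.
  apply: lerD; apply: ler_pM; rewrite ?normc_ge0 //.
  - by apply: HM; apply: cballW Hv'.
  - exact: bw.
  apply: HL => //; first by apply: cballW Hv.
    by apply: cballW Hv'.
  by move=> i; apply: Hj.
- move=> k; have [_ ->] := Hsol c cc; rewrite /F /c eqxx mul0r subr0.
  by case: eqVneq => [->|].
- exists d => // b Hb k; have [_ Eq] := Hsol b Hb; rewrite Eq /F.
  by [].
Qed.

End FixedPoint.

Section NearComp.
Variables (R : realType) (T : finType).
Local Notation C := R[i].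

Lemma near_comp (b0 : T -> C) (beta : T -> (T -> C) -> C)
    (P : (T -> C) -> Prop) :
  (forall k, lipschitz_at b0 (beta k)) -> near (beta^~ b0) P ->
  near b0 (fun b => P (beta^~ b)).
Proof.
move=> Hbeta [e e0 HP].
by apply: near_mono (near_all (fun k => lipschitz_close (Hbeta k) e0)) => b Hb;
  apply: HP.
Qed.
End NearComp.

(** * Solving for prescribed margins on a graph *)

Section GraphMargins.

Variables (R : realType) (T : finType) (e : rel T) (rt : T -> T).
Local Notation C := R[i].
Hypothesis e_sym : ssrbool.symmetric e.
Hypothesis e_irr : irreflexive e.
Hypothesis rt_edge : forall k l, e k l -> rt k = rt l.
Hypothesis rt_connect : forall k, connect e k (rt k).
Implicit Types (V : {set T}) (b z : T -> C).

Definition nbr_sum V z (k : T) : C := \sum_(l in V) (e k l)%:R * z l.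

Definition complexify (b : T -> R) : T -> C := fun k => (b k)%:C%C.

(* [sigma] is, near the real point [b0], a Lipschitz solution z of the equations
   z_k * (sum of z_l over the neighbours l of k in V) = b_k. The equation at the
   root of each component is left out, as it follows from the other ones when b
   comes from data. The condition on neighbour sums allows a further vertex to
   be attached. *)
Definition nonreal_solvable (h1 h2 : T) V : Prop :=
  exists (b0 : T -> R) (sigma : T -> (T -> C) -> C),
    [/\ forall k, lipschitz_at (complexify b0) (sigma k),
        near (complexify b0) (fun b => forall k, k \in V -> rt k != k ->
          sigma k b * nbr_sum V (sigma^~ b) k = b k),
        forall k, k \in V -> sigma k (complexify b0) != 0,
        forall v, [exists l in V, e v l] ->
          nbr_sum V (sigma^~ (complexify b0)) v != 0 &
        complex.Im (sigma h1 (complexify b0) * sigma h2 (complexify b0)) != 0].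

Lemma nbr_sumU1 V z w k : w \notin V ->
  nbr_sum (w |: V) z k = (e k w)%:R * z w + nbr_sum V z k.
Proof. exact: big_setU1. Qed.

Lemma nbr_sum_eq V z z' k : {in V, z =1 z'} -> nbr_sum V z k = nbr_sum V z' k.
Proof. by move=> H; apply: eq_bigr => l /H ->. Qed.

Lemma nbr_sum0 V z k : ~~ [exists l in V, e k l] -> nbr_sum V z k = 0.
Proof.
move=> /existsPn H; apply: big1 => l lV.
by have := H l; rewrite lV /= => /negbTE ->; rewrite mul0r.
Qed.

Lemma new_nbr V v w : [exists l in w |: V, e v l] ->
  ~~ [exists l in V, e v l] -> e v w.
Proof.
move=> /existsP[l]; rewrite in_setU1 => /andP[/predU1P[-> //|lV] vl].
by case/existsP; exists l; rewrite lV.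
Qed.

Lemma lipschitz_nbr_sum V b0 (sigma : T -> (T -> C) -> C) k :
  (forall l, lipschitz_at b0 (sigma l)) ->
  lipschitz_at b0 (fun b => nbr_sum V (sigma^~ b) k).
Proof.
move=> H; apply: lipschitz_sum => l _.
by apply: lipschitzM (H l); apply: lipschitz_cst.
Qed.

Lemma nonreal_solvable_root h1 h2 V w : h1 \in V -> h2 \in V -> w \notin V ->
  rt w = w -> (forall k l, k \in V -> e k l -> l \in V) ->
  nonreal_solvable h1 h2 V -> nonreal_solvable h1 h2 (w |: V).
Proof.
move=> h1V h2V wV rtw Vcl [b0 [sigma [Hlip Heq Hn0 Hs0 HIm]]].
have neqw k : k \in V -> k != w by apply: contraTneq => ->.
have ew k : k \in V -> e k w = false.
  by move=> kV; apply: contraNF wV; apply: Vcl.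
pose sigma' k b := if k == w then 1 else sigma k b.
have sE b k : k \in V -> sigma' k b = sigma k b.
  by move=> /neqw/negbTE kw; rewrite /sigma' kw.
have sw b : sigma' w b = 1 by rewrite /sigma' eqxx.
exists b0, sigma'; split.
- move=> k; rewrite /sigma'; case: eqP => _ //; exact: lipschitz_cst.
- apply: near_mono Heq => b Hb k; rewrite in_setU1 => /predU1P[->|kV] rtk.
    by rewrite rtw eqxx in rtk.
  rewrite nbr_sumU1 // (ew k) // mul0r add0r sE //.
  by rewrite (nbr_sum_eq (z' := sigma^~ b)) ?Hb // => l /(sE b).
- move=> k; rewrite in_setU1 => /predU1P[->|kV]; first by rewrite sw oner_eq0.
  by rewrite sE // Hn0.
- move=> v vwV; rewrite nbr_sumU1 // sw mulr1.
  rewrite (nbr_sum_eq (z' := sigma^~ (complexify b0))); last by move=> l /(sE _).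
  have [vV|vV] := boolP [exists l in V, e v l].
    have [l /andP[lV vl]] := existsP vV.
    by rewrite ew ?add0r ?Hs0 // (Vcl l) // e_sym.
  by rewrite (new_nbr vwV) // nbr_sum0 // addr0 oner_eq0.
- by rewrite !sE.
Qed.

Lemma nonreal_solvable_vertex h1 h2 V w : h1 \in V -> h2 \in V -> w \notin V ->
  rt w != w -> [exists l in V, e w l] ->
  nonreal_solvable h1 h2 V -> nonreal_solvable h1 h2 (w |: V).
Proof.
move=> h1V h2V wV rtw wnb [b0 [sigma [Hlip Heq Hn0 Hs0 HIm]]].
have neqw k : k \in V -> (k == w) = false.
  by move=> kV; apply: contraNF wV => /eqP <-.
pose Z b := nbr_sum V (sigma^~ b) w.
have Zlip : lipschitz_at (complexify b0) Z by apply: lipschitz_nbr_sum.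
have Z0 : Z (complexify b0) != 0 by apply: Hs0.
pose phi k b := (e k w)%:R * (sigma k b / Z b).
have philip k : lipschitz_at (complexify b0) (phi k).
  apply: lipschitzM; first exact: lipschitz_cst.
  by apply: lipschitzM (Hlip k) _; apply: lipschitzV.
have [beta []] := small_perturbation w philip.
set c := fun k => if k == w then 0 else complexify b0 k.
move=> betalip betac Hbeta.
have {}betac : beta^~ c = complexify b0 by apply/funext.
have comp_lip f : lipschitz_at (complexify b0) f ->
    lipschitz_at c (fun b => f (beta^~ b)).
  by move=> Hf; apply: lipschitz_comp => //; rewrite betac.
pose sigma' k b := if k == w then b w / Z (beta^~ b) else sigma k (beta^~ b).
have sE b k : k \in V -> sigma' k b = sigma k (beta^~ b).
  by move=> kV; rewrite /sigma' neqw.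
have sw b : sigma' w b = b w / Z (beta^~ b) by rewrite /sigma' eqxx.
have swc : sigma' w c = 0 by rewrite sw /c eqxx mul0r.
have Zlip' := comp_lip _ Zlip.
have slip k : lipschitz_at c (sigma' k).
  rewrite /sigma'; case: eqP => _; last exact: comp_lip.
  apply: lipschitzM; first exact: lipschitz_proj.
  by apply: lipschitzV => //; rewrite betac.
have Zn0 : near c (fun b => Z (beta^~ b) != 0).
  by apply: lipschitz_near_neq0 => //; rewrite betac.
have nbE b v : nbr_sum (w |: V) (sigma'^~ b) v =
    (e v w)%:R * sigma' w b + nbr_sum V (sigma^~ (beta^~ b)) v.
  by rewrite nbr_sumU1 // (nbr_sum_eq (z' := sigma^~ (beta^~ b))) // => l /(sE b).
have eqs : near c (fun b => forall k, k \in w |: V -> rt k != k ->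
    sigma' k b * nbr_sum (w |: V) (sigma'^~ b) k = b k).
  have Heq' : near c (fun b => forall k, k \in V -> rt k != k ->
      sigma k (beta^~ b) * nbr_sum V (sigma^~ (beta^~ b)) k = beta k b).
    by apply: (near_comp (P := fun b => forall k, k \in V -> rt k != k ->
      sigma k b * nbr_sum V (sigma^~ b) k = b k)) => //; rewrite betac.
  apply: near_mono (near_and Zn0 (near_and Heq' Hbeta)) => b [Zb [Eb Fb]] k.
  rewrite in_setU1 nbE => /predU1P[-> _|kV rtk].
    by rewrite e_irr mul0r add0r sw -/(Z _) divfK.
  rewrite sE // mulrDr Eb // Fb neqw // sw /phi.
  by field.
have nk : near c (fun b => forall k, k \in V -> sigma' k b != 0).
  apply: near_all => k; have [kV|_] := boolP (k \in V); last exact: nearT.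
  have := lipschitz_near_neq0 (slip k); rewrite sE // betac => /(_ (Hn0 k kV)).
  by apply: near_mono.
have nv : near c (fun b => forall v, [exists l in V, e v l] ->
    nbr_sum (w |: V) (sigma'^~ b) v != 0).
  apply: near_all => v; have [vV|_] := boolP [exists l in V, e v l]; last exact: nearT.
  have := lipschitz_near_neq0 (lipschitz_nbr_sum (w |: V) v slip).
  rewrite nbE swc mulr0 add0r betac => /(_ (Hs0 v vV)).
  by apply: near_mono.
have nI : near c (fun b => complex.Im (sigma' h1 b * sigma' h2 b) != 0).
  apply: (@lipschitz_near_nonreal _ _ _ (fun b => sigma' h1 b * sigma' h2 b)).
    exact: lipschitzM.
  by rewrite !sE // betac.
have nl : near c (fun b => forall k, lipschitz_at b (sigma' k)).
  by apply: near_all => k; apply: lipschitz_near.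
have [d d0 Hd] := near_and Zn0 (near_and (near_near eqs)
  (near_and nk (near_and nv (near_and nI nl)))).
pose b1 k : R := if k == w then d else b0 k.
have b1w : complexify b1 w = d%:C%C by rewrite /complexify /b1 eqxx.
have [|Zb [Eb [kb [vb [Ib lb]]]]] := Hd (complexify b1).
  move=> k; rewrite /c /complexify /b1; case: eqP => _.
    by rewrite subr0 /= expr0n addr0 sqrtr_sqr ger0_norm // ltW.
  by rewrite subrr normc0 ltW.
have swb : sigma' w (complexify b1) != 0.
  rewrite sw mulf_neq0 ?invr_eq0 // b1w.
  by apply/eqP => - [] dd; rewrite dd ltxx in d0.
exists b1, sigma'; split=> //.
- by move=> k; rewrite in_setU1 => /predU1P[->|/kb].
- move=> v vwV; have [/vb//|nvV] := boolP [exists l in V, e v l].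
  by rewrite nbE (new_nbr vwV) // mul1r nbr_sum0 // addr0.
Qed.

Lemma nonreal_solvable_setT h1 h2 V : h1 \in V -> h2 \in V ->
  (forall k, rt (rt k) = rt k) -> (forall k, k \in V -> rt k \in V) ->
  nonreal_solvable h1 h2 V -> nonreal_solvable h1 h2 [set: T].
Proof.
move=> h1V h2V rtK; have [N] := ubnP #|~: V|.
elim: N V h1V h2V => // N IH V h1V h2V; rewrite ltnS => VN Vrt HV.
have [VT|/subsetPn[w0 _ w0V]] := boolP ([set: T] \subset V).
  by have -> : [set: T] = V by apply/eqP; rewrite eqEsubset VT subsetT.
suff [w [wV rtw Hw]] : exists w,
    [/\ w \notin V, rt w \in w |: V & nonreal_solvable h1 h2 (w |: V)].
  apply: (IH (w |: V)); rewrite ?in_setU1 ?h1V ?h2V ?orbT //.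
    apply: leq_trans VN; apply: proper_card; rewrite properC.
    by apply/properP; split; [apply: subsetUr | exists w; rewrite ?setU11].
  move=> k; rewrite in_setU1 => /predU1P[-> //|/Vrt kV].
  by rewrite in_setU1 kV orbT.
have [/existsP[w /andP[wV /existsP[l /andP[lV wl]]]]|clV] :=
  boolP [exists w, (w \notin V) && [exists l in V, e w l]].
  have rtwV : rt w \in V by rewrite (rt_edge wl) Vrt.
  exists w; split=> //; first by rewrite in_setU1 rtwV orbT.
  apply: nonreal_solvable_vertex => //; last by apply/existsP; exists l; rewrite lV.
  by apply: contraNneq wV => <-.
have Vcl k l : k \in V -> e k l -> l \in V.
  move=> kV kl; apply: contraNT clV => lV.
  apply/existsP; exists l; rewrite lV; apply/existsP; exists k.
  by rewrite kV e_sym.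
have cl : closed e (mem V).
  by apply: intro_closed => [|k l kl kV]; [apply: sym_connect_sym | apply: Vcl kl].
exists (rt w0).
have rw0 : rt w0 \notin V by rewrite -(closed_connect cl (rt_connect w0)).
by split; rewrite ?rtK ?setU11 //; apply: nonreal_solvable_root.
Qed.

End GraphMargins.

Section SquareRoot.

Variables (R : realType) (T : finType).
Local Notation C := R[i].

(* The square root with nonnegative imaginary part, continuous away from the
   nonnegative reals. *)
Definition upper_sqrt (x : C) : C := 'i%C * sqrtc (- x).

Lemma sqr_upper_sqrt x : upper_sqrt x ^+ 2 = x.
Proof. by rewrite exprMn sqr_i sqr_sqrtc mulN1r opprK. Qed.

Lemma Im_upper_sqrt x : 0 <= complex.Im (upper_sqrt x).
Proof.
rewrite /upper_sqrt mulrC ImiRe; case: (- x) => a b /=; exact: sqrtr_ge0.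
Qed.

Lemma upper_sqrt_neg (a : R) : 0 <= a -> upper_sqrt (- a ^+ 2)%:C%C = 'i%C * a%:C%C.
Proof.
move=> a0; rewrite /upper_sqrt -rmorphN opprK sqrtc_sqrtr ?sqr_ge0 //=.
  by rewrite sqrtr_sqr ger0_norm.
by rewrite lecR sqr_ge0.
Qed.

Lemma lipschitz_upper_sqrt (b0 : T -> C) (f : (T -> C) -> C) (a : R) :
  lipschitz_at b0 f -> 0 < a -> f b0 = (- a ^+ 2)%:C%C ->
  lipschitz_at b0 (fun b => upper_sqrt (f b)).
Proof.
move=> Hf a0 f0; have a20 : 0 < a ^+ 2 / 2 by rewrite divr_gt0 ?exprn_gt0.
have [e1 e10 Cf] := lipschitz_close Hf a20.
have [e [L [e0 L0 {}Hf]]] := Hf.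
have ImD (x y : C) : complex.Im (x + y) = complex.Im x + complex.Im y.
  by case: x y => [? ?] [? ?].
have near_ia b : cball b0 e1 b -> a / 2 <= complex.Im (upper_sqrt (f b)).
  move=> /Cf; set s := upper_sqrt (f b); rewrite f0 -(sqr_upper_sqrt (f b)) -/s.
  have -> : s ^+ 2 - (- a ^+ 2)%:C%C = (s - 'i%C * a%:C%C) * (s + 'i%C * a%:C%C).
    rewrite -subr_sqr; congr (_ - _).
    by rewrite exprMn sqr_i mulN1r rmorphN rmorphXn.
  rewrite normcM => H.
  have Is : complex.Im s >= 0 by apply: Im_upper_sqrt.
  have h1 : a <= normc (s + 'i%C * a%:C%C).
    apply: le_trans (Im_le_normc _); apply: le_trans (ler_norm _).
    by rewrite ImD [_ * a%:C%C]mulrC ImiRe /=; lra.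
  have h2 : normc (s - 'i%C * a%:C%C) <= a / 2.
    have : normc (s - 'i%C * a%:C%C) * a <= a ^+ 2 / 2.
      by apply: le_trans H; rewrite ler_wpM2l ?normc_ge0.
    by rewrite expr2 mulrAC ler_pM2r.
  have := le_trans (ler_norm _) (le_trans (Im_le_normc ('i%C * a%:C%C - s)) _).
  move/(_ (a / 2)); rewrite normc_distC => /(_ h2).
  have -> : complex.Im ('i%C * a%:C%C - s) = a - complex.Im s.
    by rewrite mulrC; case: s {H Is h1 h2} => u v /=; rewrite mulr1 mul0r addr0.
  lra.
exists (Num.min e e1), (L / a); rewrite lt_min e0 e10 divr_gt0 //; split=> //.
move=> b b' d d0 Hb Hb' Hd.
have W1 : Num.min e e1 <= e by rewrite ge_min lexx.
have W2 : Num.min e e1 <= e1 by rewrite ge_min lexx orbT.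
rewrite mulrAC ler_pdivlMr //.
apply: le_trans (Hf b b' d d0 (cballW W1 Hb) (cballW W1 Hb') Hd).
have -> : f b' - f b = (upper_sqrt (f b') - upper_sqrt (f b)) *
    (upper_sqrt (f b') + upper_sqrt (f b)).
  by rewrite -subr_sqr !sqr_upper_sqrt.
rewrite normcM ler_wpM2l ?normc_ge0 //.
apply: le_trans (Im_le_normc _); apply: le_trans (ler_norm _).
have := near_ia _ (cballW W2 Hb); have := near_ia _ (cballW W2 Hb').
by rewrite ImD; lra.
Qed.

End SquareRoot.

Section Hexagon.

Variables (R : realType) (T : finType) (e : rel T) (rt : T -> T).
Local Notation C := R[i].
Variables (side : pred T) (x1 x2 x3 y1 y2 y3 : T).
Hypothesis e_sym : ssrbool.symmetric e.
Hypothesis e_side : forall k l, e k l -> side k != side l.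
Let hexagon := [:: x1; x2; x3; y1; y2; y3].
Hypothesis hexagon_uniq : uniq hexagon.
Hypothesis x_side : [&& side x1, side x2 & side x3].
Hypothesis y_side : [&& ~~ side y1, ~~ side y2 & ~~ side y3].
Hypothesis x1_edges : [&& e x1 y1, e x1 y2 & e x1 y3].
Hypothesis x2_edges : [&& e x2 y1, e x2 y2 & ~~ e x2 y3].
Hypothesis x3_edges : [&& e x3 y1, ~~ e x3 y2 & e x3 y3].
Hypothesis rt_y1 : rt y1 = y1.

Lemma nbr_sum_seq (s : seq T) (z : T -> C) k : uniq s ->
  nbr_sum e [set l in s] z k = \sum_(l <- s) (e k l)%:R * z l.
Proof. by move=> us; rewrite big_uniq //; apply: eq_bigl => l; rewrite inE. Qed.

(* With y1 = 1, put p22 = x2 y2 and p33 = x3 y3. The binomial relations become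
   p22 (p33 + al) = be and p33 (p22 + ga) = de, and eliminating p33 leaves
   al p22^2 + mid p22 = be ga, whose discriminant is disc. At the base point
   disc = -16, x = (1 + 2i, -1 - i, -1 - i) and y = (1, -i, -i). *)
Let al (b : T -> C) := b x1 + b x2 - b y3.
Let ga (b : T -> C) := b x1 + b x3 - b y2.
Let be (b : T -> C) := b y2 * b x2.
Let de (b : T -> C) := b y3 * b x3.
Let mid b := al b * ga b + de b - be b.
Let disc b := mid b ^+ 2 + 4 * (al b * be b * ga b).
Let p22 b := (upper_sqrt (disc b) - mid b) / (2 * al b).
Let p33 b := (al b * p22 b - be b + de b) / ga b.
Let p11 (b : T -> C) := b x1 - b y2 - b y3 + p22 b + p33 b.

Let sigma k b :=
  if k == y1 then 1 else if k == x1 then p11 b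
  else if k == x2 then b x2 - p22 b else if k == x3 then b x3 - p33 b
  else if k == y2 then (b y2 - p22 b) / p11 b else (b y3 - p33 b) / p11 b.

Let base : T -> R := fun k =>
  if k == x1 then 5 else if (k == x2) || (k == x3) then -2 else 1.

Lemma nonreal_solvable_hexagon : nonreal_solvable R e rt x2 y1 [set l in hexagon].
Proof.
have := hexagon_uniq; rewrite /hexagon /= !inE !negb_or.
case/and5P => /and5P[n12 n13 n1a n1b n1c] /and4P[n23 n2a n2b n2c].
case/and3P=> n3a n3b n3c /andP[nab nac] /andP[nbc _].
have s1 b : sigma y1 b = 1 by rewrite /sigma eqxx.
have s2 b : sigma x1 b = p11 b by rewrite /sigma eqxx (negbTE n1a).
have s3 b : sigma x2 b = b x2 - p22 b.
  by rewrite /sigma eqxx (negbTE n2a) eq_sym (negbTE n12).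
have s4 b : sigma x3 b = b x3 - p33 b.
  by rewrite /sigma eqxx (negbTE n3a) !(eq_sym x3) (negbTE n13) (negbTE n23).
have s5 b : sigma y2 b = (b y2 - p22 b) / p11 b.
  by rewrite /sigma eqxx !(eq_sym y2) (negbTE nab) (negbTE n1b) (negbTE n2b) (negbTE n3b).
have s6 b : sigma y3 b = (b y3 - p33 b) / p11 b.
  rewrite /sigma !(eq_sym y3) (negbTE nac) (negbTE n1c) (negbTE n2c).
  by rewrite (negbTE n3c) (negbTE nbc).
have exx k l : side k -> side l -> e k l = false.
  by move=> ks ls; apply/negP => /e_side; rewrite ks ls.
have eyy k l : ~~ side k -> ~~ side l -> e k l = false.
  by move=> /negbTE ks /negbTE ls; apply/negP => /e_side; rewrite ks ls.
case/and3P: x_side => x1s x2s x3s; case/and3P: y_side => y1s y2s y3s.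
case/and3P: x1_edges => e11 e12 e13.
case/and3P: x2_edges => e21 e22 /negbTE e23.
case/and3P: x3_edges => e31 /negbTE e32 e33.
set b0 := complexify base.
have v1 : b0 x1 = 5 by rewrite /b0 /complexify /base eqxx rmorph_nat.
have v2 : b0 x2 = -2.
  by rewrite /b0 /complexify /base eqxx eq_sym (negbTE n12) rmorphN rmorph_nat.
have v3 : b0 x3 = -2.
  by rewrite /b0 /complexify /base eqxx orbT eq_sym (negbTE n13) rmorphN rmorph_nat.
have v5 : b0 y2 = 1.
  by rewrite /b0 /complexify /base !(eq_sym y2) (negbTE n1b) (negbTE n2b) (negbTE n3b).
have v6 : b0 y3 = 1.
  by rewrite /b0 /complexify /base !(eq_sym y3) (negbTE n1c) (negbTE n2c) (negbTE n3c).
have a0 : al b0 = 2 by rewrite /al v1 v2 v6; ring.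
have g0 : ga b0 = 2 by rewrite /ga v1 v3 v5; ring.
have m0 : mid b0 = 4 by rewrite /mid a0 g0 /be /de v2 v3 v5 v6; ring.
have d0 : disc b0 = (- 4 ^+ 2)%:C%C.
  by rewrite /disc m0 a0 g0 /be v2 v5 rmorphN rmorphXn rmorph_nat; ring.
have S0 : upper_sqrt (disc b0) = 'i%C * 4.
  by rewrite d0 upper_sqrt_neg ?rmorph_nat.
have t0 : p22 b0 = 'i%C - 1 by rewrite /p22 S0 m0 a0; field.
have w0 : p33 b0 = 'i%C - 1.
  by rewrite /p33 t0 a0 g0 /be /de v2 v3 v5 v6; field.
have q0 : p11 b0 = Complex 1 2.
  rewrite /p11 t0 w0 v1 v5 v6.
  by apply/eqP; rewrite eq_complex /=; apply/andP; split; apply/eqP => /=; ring.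
have q0n : p11 b0 != 0 by rewrite q0; apply/eqP => - [] /eqP; rewrite oner_eq0.
have c2 : sigma x1 b0 = Complex 1 2 by rewrite s2.
have c3 : sigma x2 b0 = Complex (-1) (-1).
  rewrite s3 t0 v2.
  by apply/eqP; rewrite eq_complex /=; apply/andP; split; apply/eqP => /=; ring.
have c4 : sigma x3 b0 = Complex (-1) (-1).
  rewrite s4 w0 v3.
  by apply/eqP; rewrite eq_complex /=; apply/andP; split; apply/eqP => /=; ring.
have c5' : (1 - ('i%C - 1)) / Complex 1 2 = Complex 0 (-1) :> C.
  apply: (canLR (mulfK _)); first by rewrite -q0.
  by apply/eqP; rewrite eq_complex /=; apply/andP; split; apply/eqP => /=; ring.
have c5 : sigma y2 b0 = Complex 0 (-1) by rewrite s5 t0 v5 q0.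
have c6 : sigma y3 b0 = Complex 0 (-1) by rewrite s6 w0 v6 q0.
have n2 : (2 : C) != 0 by rewrite pnatr_eq0.
have lal : lipschitz_at b0 al.
  by do ![apply: lipschitzB | apply: lipschitzD]; apply: lipschitz_proj.
have lga : lipschitz_at b0 ga.
  by do ![apply: lipschitzB | apply: lipschitzD]; apply: lipschitz_proj.
have lbe : lipschitz_at b0 be by apply: lipschitzM; apply: lipschitz_proj.
have lde : lipschitz_at b0 de by apply: lipschitzM; apply: lipschitz_proj.
have lmid : lipschitz_at b0 mid.
  by apply: lipschitzB => //; apply: lipschitzD => //; apply: lipschitzM.
have ldisc : lipschitz_at b0 disc.
  apply: lipschitzD; first exact: lipschitzM.
  apply: lipschitzM; first exact: lipschitz_cst.
  by apply: lipschitzM => //; apply: lipschitzM.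
have lp22 : lipschitz_at b0 p22.
  apply: lipschitzM.
    apply: lipschitzB => //; apply: (lipschitz_upper_sqrt ldisc _ d0).
    by rewrite ltr0n.
  apply: lipschitzV; last by rewrite a0 mulf_neq0.
  by apply: lipschitzM => //; apply: lipschitz_cst.
have lp33 : lipschitz_at b0 p33.
  apply: lipschitzM; last by apply: lipschitzV => //; rewrite g0.
  by apply: lipschitzD => //; apply: lipschitzB => //; apply: lipschitzM.
have lp11 : lipschitz_at b0 p11.
  apply: lipschitzD => //; apply: lipschitzD => //.
  by do ![apply: lipschitzB | apply: lipschitzD]; apply: lipschitz_proj.
exists base, sigma; split.
- move=> k; rewrite /sigma; do ![case: eqP => _] => //.
  + exact: lipschitz_cst.
  + by apply: lipschitzB => //; apply: lipschitz_proj.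
  + by apply: lipschitzB => //; apply: lipschitz_proj.
  + apply: lipschitzM; last exact: lipschitzV.
    by apply: lipschitzB => //; apply: lipschitz_proj.
  + apply: lipschitzM; last exact: lipschitzV.
    by apply: lipschitzB => //; apply: lipschitz_proj.
- have na : near b0 (fun b => al b != 0) by apply: lipschitz_near_neq0; rewrite ?a0.
  have ng : near b0 (fun b => ga b != 0) by apply: lipschitz_near_neq0; rewrite ?g0.
  have np : near b0 (fun b => p11 b != 0) by apply: lipschitz_near_neq0.
  apply: near_mono (near_and na (near_and ng np)) => b [ab [gb pb]] k.
  have e1 : p22 b * (p33 b + al b) = be b.
    have h : al b * p22 b ^+ 2 + mid b * p22 b = be b * ga b.
      have h4 : 4 * al b != 0 by rewrite mulf_neq0 ?pnatr_eq0.
      apply: (mulfI h4).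
      have h2 : 2 * al b * p22 b = upper_sqrt (disc b) - mid b.
        by rewrite mulrC divfK ?mulf_neq0.
      have h3 : (2 * al b * p22 b + mid b) ^+ 2 = disc b.
        by rewrite h2 subrK sqr_upper_sqrt.
      transitivity ((2 * al b * p22 b + mid b) ^+ 2 - mid b ^+ 2); first by ring.
      by rewrite h3 /disc; ring.
    apply: (mulIf gb); rewrite -h /p33 /mid; by field.
  have e2 : p33 b * (p22 b + ga b) = de b.
    have h : p33 b * ga b = al b * p22 b - be b + de b by rewrite divfK.
    by rewrite mulrDr [p33 b * ga b]h -e1; ring.
  have e3 : (b x2 - p22 b) * (b y2 - p22 b) = p22 b * p11 b.
    rewrite /p11; have : p22 b * (p33 b + al b) - be b = 0 by rewrite e1 subrr.
    rewrite /al /be => h; apply/eqP.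
    by rewrite -subr_eq0 -oppr_eq0 -[X in _ == X]h; apply/eqP; ring.
  have e4 : (b x3 - p33 b) * (b y3 - p33 b) = p33 b * p11 b.
    rewrite /p11; have : p33 b * (p22 b + ga b) - de b = 0 by rewrite e2 subrr.
    rewrite /ga /de => h; apply/eqP.
    by rewrite -subr_eq0 -oppr_eq0 -[X in _ == X]h; apply/eqP; ring.
  have nb l : nbr_sum e [set l in hexagon] (sigma^~ b) l = (e l x1)%:R * p11 b +
      ((e l x2)%:R * (b x2 - p22 b) + ((e l x3)%:R * (b x3 - p33 b) +
      ((e l y1)%:R * 1 + ((e l y2)%:R * ((b y2 - p22 b) / p11 b) +
      (e l y3)%:R * ((b y3 - p33 b) / p11 b))))).
    by rewrite nbr_sum_seq // !big_cons big_nil s1 s2 s3 s4 s5 s6 addr0.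
  rewrite inE nb !inE => kh rtk.
  have e3' : (b x2 - p22 b) * ((b y2 - p22 b) / p11 b) = p22 b.
    by rewrite mulrA e3 mulfK.
  have e4' : (b x3 - p33 b) * ((b y3 - p33 b) / p11 b) = p33 b.
    by rewrite mulrA e4 mulfK.
  move: kh; case/or4P=> [/eqP->|/eqP->|/eqP->|].
  + rewrite s2 (exx x1 x1) // (exx x1 x2) // (exx x1 x3) // e11 e12 e13.
    rewrite /= !mulr0n !mulr1n.
    by transitivity (p11 b + (b y2 - p22 b) + (b y3 - p33 b));
      [field | rewrite /p11; ring].
  + rewrite s3 (exx x2 x1) // (exx x2 x2) // (exx x2 x3) // e21 e22 e23.
    rewrite /= !mulr0n !mulr1n.
    rewrite !mul0r !mul1r !add0r addr0 mulrDr mulr1 e3'; ring.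
  + rewrite s4 (exx x3 x1) // (exx x3 x2) // (exx x3 x3) // e31 e32 e33.
    rewrite /= !mulr0n !mulr1n.
    rewrite !mul0r !mul1r !add0r mulrDr mulr1 e4'; ring.
  + case/or3P=> /eqP k_eq; move: rtk; rewrite k_eq.
    * by rewrite rt_y1 eqxx.
    * rewrite s5 (eyy y2 y1) // (eyy y2 y2) // (eyy y2 y3) // !(e_sym y2) e12 e22 e32 => _.
      rewrite /= !mulr0n !mulr1n.
      rewrite !mul0r !mul1r !addr0 mulrDr -mulrA mulVf // mulr1.
      by rewrite [_ * (b x2 - _)]mulrC e3'; ring.
    * rewrite s6 (eyy y3 y1) // (eyy y3 y2) // (eyy y3 y3) // !(e_sym y3) e13 e23 e33 => _.
      rewrite /= !mulr0n !mulr1n.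
      rewrite !mul0r !mul1r !addr0 !add0r mulrDr -mulrA mulVf // mulr1.
      by rewrite [_ * (b x3 - _)]mulrC e4'; ring.
- have nz (a c : R) : (a != 0) || (c != 0) -> Complex a c != 0.
    by rewrite eq_complex negb_and.
  move=> k; rewrite inE !inE; case/or4P=> [/eqP->|/eqP->|/eqP->|].
  + by rewrite c2 nz // oner_eq0.
  + by rewrite c3 nz // oppr_eq0 oner_eq0.
  + by rewrite c4 nz // oppr_eq0 oner_eq0.
  + case/or3P=> /eqP->; rewrite ?s1 ?oner_eq0 // ?c5 ?c6 nz //.
      by rewrite oppr_eq0 oner_eq0 orbT.
    by rewrite oppr_eq0 oner_eq0 orbT.
- move=> v /existsP[l]; rewrite inE !inE => /andP[lh vl].
  rewrite nbr_sum_seq // !big_cons big_nil s1 c2 c3 c4 c5 c6 addr0.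
  have [sv|sv] := boolP (side v).
    rewrite (exx v x1) // (exx v x2) // (exx v x3) //= !mulr0n !mul0r !add0r.
    have : [|| e v y1, e v y2 | e v y3].
      move: lh vl; case/or4P=> [/eqP->|/eqP->|/eqP->|]; try by rewrite exx.
      by case/or3P=> /eqP-> ->; rewrite ?orbT.
    case: (e v y1) (e v y2) (e v y3) => [] [] [] //= _;
      rewrite ?mulr0n ?mulr1n ?mul0r ?mul1r ?addr0 ?add0r eq_complex /= negb_and; apply/orP;
      by first [left; apply/eqP; lra | right; apply/eqP; lra].
  rewrite (eyy v y1) // (eyy v y2) // (eyy v y3) //= !mulr0n !mul0r !addr0.
  have : [|| e v x1, e v x2 | e v x3].
    move: lh vl; case/or4P=> [/eqP-> ->|/eqP-> ->|/eqP-> ->|]; rewrite ?orbT //=.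
    by case/or3P=> /eqP->; rewrite eyy.
  case: (e v x1) (e v x2) (e v x3) => [] [] [] //= _;
    rewrite ?mulr0n ?mulr1n ?mul0r ?mul1r ?addr0 ?add0r eq_complex /= negb_and; apply/orP;
    by first [left; apply/eqP; lra | right; apply/eqP; lra].
- by rewrite s1 c3 mulr1 /= oppr_eq0 oner_eq0.
Qed.

End Hexagon.

(** * Polynomials vanishing on a grid *)

Section GridNonvanishing.

Variable K : fieldType.

Definition infinite_pred (E : K -> Prop) : Prop :=
  forall s : seq K, exists2 x, E x & x \notin s.

Lemma poly_infinite_neq0 (E : K -> Prop) (q : {poly K}) :
  infinite_pred E -> q != 0 -> exists2 x, E x & q.[x] != 0.
Proof.
move=> Einf q0.
suff [s [us sE ss]] : exists s : seq K,
    [/\ uniq s, forall x, x \in s -> E x & size s = size q].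
  have /allPn[x xs nx] : ~~ all (root q) s.
    by apply/negP => rs; have := max_poly_roots q0 rs us; rewrite ss ltnn.
  by exists x => //; apply: sE.
elim: (size q) => [|N [s [us sE ss]]]; first by exists [::].
have [x Ex xs] := Einf s; exists (x :: s); rewrite /= xs us ss; split=> //.
by move=> y; rewrite in_cons => /predU1P[-> //|/sE].
Qed.

Lemma muni_eq0 n (g : {mpoly K[n.+1]}) : muni g = 0 -> g = 0.
Proof.
move=> g0; apply/mpolyP => m; rewrite mcoeff0.
have := congr1 (fun q : {poly {mpoly K[n]}} =>
  (q`_(m ord_max))@_[multinom m (widen_ord (leqnSn n) i) | i < n]) g0.
rewrite muniE coef0 mcoeff0 coef_sum raddf_sum /= => <-.
have term m' : ((g@_m' *: 'X_[[multinom m' (widen_ord (leqnSn n) i) | i < n]] *: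
    'X^(m' ord_max))`_(m ord_max))@_[multinom m (widen_ord (leqnSn n) i) | i < n]
    = g@_m' * (m' == m)%:R.
  rewrite coefZ coefXn -mulr_natr; case: (eqVneq m' m) => [->|nm].
    by rewrite eqxx !mulr1 mcoeffZ mcoeffX eqxx mulr1.
  rewrite mulr0; case: eqP => [e1|_]; last by rewrite !mulr0 mcoeff0.
  rewrite !mulr1 mcoeffZ mcoeffX; case: eqP => [e2|_]; last by rewrite mulr0.
  case/eqP: nm; apply/mnmP => i; case: (unliftP ord_max i) => [j ->|-> //].
  have := congr1 (fun w : 'X_{1..n} => w j) e2; rewrite !mnmE.
  have -> : lift ord_max j = widen_ord (leqnSn n) j by apply/val_inj/lift_max.
  by [].
under eq_bigr => m' _ do rewrite term.
have [mg|mg] := boolP (m \in msupp g).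
  rewrite (bigD1_seq m) ?msupp_uniq //= eqxx mulr1 big1 ?addr0 //.
  by move=> m' /negbTE ->; rewrite mulr0.
rewrite (memN_msupp_eq0 mg) big_seq big1 // => m' m'g.
by case: eqVneq => [mm|]; rewrite ?mulr0 //; rewrite mm (negbTE mg) in m'g.
Qed.

Lemma muni_meval n (g : {mpoly K[n.+1]}) (v : 'I_n.+1 -> K) :
  g.@[v] = (map_poly (meval (fun i => v (widen_ord (leqnSn n) i))) (muni g)).[v ord_max].
Proof.
rewrite muniE raddf_sum horner_sum mevalE; apply: eq_bigr => m _.
rewrite /= map_polyZ map_polyXn hornerZ hornerXn /= mevalZ mevalX -mulrA.
rewrite big_ord_recr /=; congr (_ * (_ * _)).
by apply: eq_bigr => i _; rewrite mnmE.
Qed.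

Lemma mpoly_infinite_neq0 n (E : 'I_n -> K -> Prop) (g : {mpoly K[n]}) :
  (forall i, infinite_pred (E i)) -> g != 0 ->
  exists2 v, forall i, E i (v i) & g.@[v] != 0.
Proof.
elim: n E g => [|n IHn] E g Einf g0.
  exists (fun=> 0); first by case.
  apply: contraNneq g0 => gv; apply/eqP/mpolyP => m; rewrite mcoeff0.
  move: gv; rewrite mevalE.
  under eq_bigr => m' _ do rewrite big_ord0 mulr1.
  have one (m' : 'X_{1..0}) : m' = m by apply/mnmP; case.
  have [mg|mg _] := boolP (m \in msupp g); last exact: memN_msupp_eq0.
  rewrite (bigD1_seq m) ?msupp_uniq //= big1 ?addr0 // => m'.
  by rewrite (one m') eqxx.
have [k gk] : exists k, (muni g)`_k != 0.
  exists (size (muni g)).-1; rewrite -/(lead_coef _) lead_coef_eq0.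
  by apply: contra_neq g0; apply: muni_eq0.
have [v Ev gv] := IHn (fun i => E (widen_ord (leqnSn n) i)) _
  (fun i => Einf (widen_ord (leqnSn n) i)) gk.
have q0 : map_poly (meval v) (muni g) != 0.
  apply: contraNneq gv => q0; have := congr1 (fun q : {poly K} => q`_k) q0.
  by rewrite coef_map coef0 /= => ->.
have [x Ex qx] := poly_infinite_neq0 (Einf ord_max) q0.
pose w i := if unlift ord_max i is Some j then v j else x.
have wM : w ord_max = x by rewrite /w unlift_none.
have wW i : w (widen_ord (leqnSn n) i) = v i.
  have -> : widen_ord (leqnSn n) i = lift ord_max i by apply/val_inj/esym/lift_max.
  by rewrite /w liftK.
exists w.
  move=> i; case: (unliftP ord_max i) => [j ->|->]; last by rewrite wM.
  have -> : lift ord_max j = widen_ord (leqnSn n) j by apply/val_inj/lift_max.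
  by rewrite wW.
rewrite muni_meval wM; congr (_ != 0): qx.
by congr (_.[x]); apply: eq_map_poly => c; apply: meval_eq => i; rewrite wW.
Qed.

End GridNonvanishing.

(** * Critical points of the likelihood *)

Section CriticalPoints.

Variables (R : realType) (m n : nat) (S : {set 'I_m * 'I_n}).
Local Notation C := R[i].
Local Notation N := #|S|.
Local Notation toC := (real_complex R).

Definition cell (s : 'I_N) : 'I_m * 'I_n := enum_val s.

Lemma mul_quasi_independence_mx (F : pzRingType) (u : 'rV[F]_m) (v : 'rV[F]_n) s :
  (row_mx u v *m quasi_independence_mx F S) 0 s = u 0 (cell s).1 + v 0 (cell s).2.
Proof.
rewrite mul_row_col mxE; congr (_ + _); rewrite mxE.
  rewrite (bigD1 (cell s).1) //= !mxE inE eqxx mulr1 big1 ?addr0 // => i ni.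
  by rewrite !mxE inE eq_sym (negbTE ni) mulr0.
rewrite (bigD1 (cell s).2) //= !mxE inE eqxx mulr1 big1 ?addr0 // => i ni.
by rewrite !mxE inE eq_sym (negbTE ni) mulr0.
Qed.

Lemma map_quasi_independence_mx (F G : pzRingType) (f : {rmorphism F -> G}) :
  map_mx f (quasi_independence_mx F S) = quasi_independence_mx G S.
Proof.
apply/matrixP => i s; rewrite !mxE; case: (split i) => k;
  by rewrite !mxE rmorph_nat.
Qed.

Lemma model_monomial (x : 'I_m -> R) (y : 'I_n -> R) : (0 < N)%N ->
  (forall i, 0 < x i) -> (forall j, 0 < y j) ->
  model (\row_s (x (cell s).1 * y (cell s).2 /
                 \sum_s' x (cell s').1 * y (cell s').2)).
Proof.
move=> N0 x0 y0; set z := \sum_s' _.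
have t0 s : 0 < x (cell s).1 * y (cell s).2 by rewrite mulr_gt0.
have z0 : 0 < z.
  rewrite /z (bigD1 (Ordinal N0)) //= ltr_wpDr //.
  by apply: sumr_ge0 => s _; rewrite ltW.
split=> [s||]; first by rewrite mxE divr_gt0.
  under eq_bigr => s _ do rewrite mxE.
  by rewrite -mulr_suml divff // gt_eqF.
apply/submxP; exists (row_mx (\row_i (exp.ln (x i) - exp.ln z)) (\row_j exp.ln (y j))).
apply/rowP => s; rewrite mul_quasi_independence_mx !mxE.
by rewrite exp.ln_div ?exp.lnM ?posrE // addrAC.
Qed.

Section Homogenization.
Variable f : {mpoly C[N]}.
Let Xc (s : 'I_N) : {mpoly C[m + n]} :=
  'X_(lshift n (cell s).1) * 'X_(rshift m (cell s).2).

(* Clears the denominators of f at the point (x_i y_j / \sum x_i y_j). *)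
Definition homogenization : {mpoly C[m + n]} :=
  \sum_(d <- msupp f) f@_d *: ((\sum_s Xc s) ^+ (msize f - mdeg d) *
                               \prod_s Xc s ^+ d s).

Lemma homogenizationE (v : 'I_(m + n) -> C) :
  let t s := v (lshift n (cell s).1) * v (rshift m (cell s).2) in
  \sum_s t s != 0 ->
  homogenization.@[v] = (\sum_s t s) ^+ msize f * f.@[fun s => t s / \sum_s' t s'].
Proof.
move=> t; set z := \sum_s t s => z0.
have Xv s : (Xc s).@[v] = t s by rewrite mevalM !mevalXU.
rewrite raddf_sum [f.@[_]]mevalE mulr_sumr big_seq [RHS]big_seq; apply: eq_bigr => d df.
rewrite /= mevalZ mevalM rmorphXn rmorph_prod raddf_sum /= [RHS]mulrCA.
have -> : \sum_s (Xc s).@[v] = z by apply: eq_bigr => s _; apply: Xv.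
have -> : \prod_s (Xc s ^+ d s).@[v] = \prod_s t s ^+ d s.
  by apply: eq_bigr => s _; rewrite rmorphXn /= Xv.
have -> : \prod_s (t s / z) ^+ d s = \prod_s (t s ^+ d s / z ^+ d s).
  by apply: eq_bigr => s _; rewrite expr_div_n.
congr (_ * _).
rewrite big_split /= prodfV -expr_sum -mdegE [RHS]mulrCA mulrC; congr (_ * _).
by rewrite expfB_cond // (negbTE z0) /= ltnW // msize_mdeg_lt.
Qed.

End Homogenization.

Lemma infinite_seq (K : fieldType) (E : K -> Prop) (f : nat -> K) :
  injective f -> (forall k, E (f k)) -> infinite_pred E.
Proof.
move=> finj Ef s; have /allPn[x] : ~~ all (mem s) (map f (iota 0 (size s).+1)).
  apply/negP => /allP H; have := uniq_leq_size _ H.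
  by rewrite map_inj_uniq // iota_uniq size_map size_iota ltnn => /(_ isT).
by case/mapP => k _ -> ns; exists (f k).
Qed.

Lemma monomial_zariski_closure (x : 'I_m -> C) (y : 'I_n -> C) :
  \sum_s x (cell s).1 * y (cell s).2 = 1 ->
  zariski_closure (complex_model (S := S))
    (\row_s (x (cell s).1 * y (cell s).2)).
Proof.
move=> sum1 f fV.
have N0 : (0 < N)%N.
  rewrite lt0n; apply/eqP => N0; move: sum1; rewrite big1 => [/eqP|s].
    by rewrite eq_sym oner_eq0.
  by have := ltn_ord s; rewrite [X in (_ < X)%N]N0.
have Q0 : homogenization f = 0.
  apply/eqP/negPn/negP => Qn0.
  pose E (z : C) := exists2 a : R, 0 < a & z = a%:C%C.
  have Einf : infinite_pred E.
    apply: (@infinite_seq _ _ (fun k => k.+1%:R)).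
      by move=> k l /eqP; rewrite eqr_nat eqSS => /eqP.
    by move=> k; exists k.+1%:R => //; rewrite rmorph_nat.
  have [v Ev] := mpoly_infinite_neq0 (fun=> Einf) Qn0.
  have /choice[a Ha] : forall k, exists a : R, 0 < a /\ v k = a%:C%C.
    by move=> k; have [a a0 va] := Ev k; exists a.
  pose xa i := a (lshift n i); pose ya j := a (rshift m j).
  have vE s : v (lshift n (cell s).1) * v (rshift m (cell s).2) =
      toC (xa (cell s).1 * ya (cell s).2).
    by rewrite !(proj2 (Ha _)) rmorphM.
  have sE : \sum_s v (lshift n (cell s).1) * v (rshift m (cell s).2) =
      toC (\sum_s xa (cell s).1 * ya (cell s).2).
    by rewrite rmorph_sum; apply: eq_bigr => s _; rewrite vE.
  have z0 : 0 < \sum_s xa (cell s).1 * ya (cell s).2.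
    rewrite (bigD1 (Ordinal N0)) //= ltr_wpDr ?mulr_gt0 ?(proj1 (Ha _)) //.
    by apply: sumr_ge0 => s _; rewrite ltW ?mulr_gt0 ?(proj1 (Ha _)).
  case/eqP; rewrite homogenizationE sE; last first.
    by apply/eqP => -[] zz; rewrite zz ltxx in z0.
  set q := \row_s (xa (cell s).1 * ya (cell s).2 /
                   \sum_s' xa (cell s').1 * ya (cell s').2).
  have qV : complex_model (map_mx toC q).
    by exists q => //; apply: model_monomial => // k; apply: (proj1 (Ha _)).
  rewrite (meval_eq (v2 := fun s => map_mx toC q 0 s)) ?fV ?mulr0 // => s.
  by rewrite !mxE vE -fmorph_div.
pose v (k : 'I_(m + n)) := match split k with inl i => x i | inr j => y j end.
have vl i : v (lshift n i) = x i by rewrite /v (unsplitK (inl i)).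
have vr j : v (rshift m j) = y j by rewrite /v (unsplitK (inr j)).
have sE : \sum_s v (lshift n (cell s).1) * v (rshift m (cell s).2) = 1.
  by under eq_bigr => s _ do rewrite vl vr.
have /= := homogenizationE f (v := v); rewrite sE oner_eq0 Q0 meval0 => /(_ isT).
rewrite expr1n mul1r => ->; apply: meval_eq => s.
by rewrite mxE vl vr divr1.
Qed.

Lemma tangent_integer_kernel (p w : 'rV[C]_N) (k : 'rV[int]_N) :
  zariski_closure (complex_model (S := S)) p -> (forall s, p 0 s != 0) ->
  zariski_tangent (complex_model (S := S)) p w ->
  k *m (quasi_independence_mx int S)^T = 0 ->
  \sum_s (k 0 s)%:~R * (w 0 s / p 0 s) = 0.
Proof.
move=> pV p0 wT kA.
pose kp : 'X_{1..N} := [multinom (if (0 <= k 0 s)%R then absz (k 0%R s) else 0%N) | s < N].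
pose kn : 'X_{1..N} := [multinom (if (0 <= k 0 s)%R then 0%N else absz (k 0%R s)) | s < N].
have kE s : k 0 s = (kp s)%:Z - (kn s)%:Z.
  rewrite !mnmE; case: ifP => ks; first by rewrite gez0_abs ?subr0.
  by rewrite ltz0_abs ?sub0r ?opprK // ltNge ks.
pose f : {mpoly C[N]} := 'X_[kp] - 'X_[kn].
have fV : vanishing (complex_model (S := S)) f.
  move=> _ [q [q0 _ /submxP[l ql]] ->].
  rewrite mevalB !mevalX; apply/eqP; rewrite subr_eq0; apply/eqP.
  have qE (d : 'X_{1..N}) : \prod_s map_mx toC q 0 s ^+ d s =
      toC (sequences.expR (\sum_s (d s)%:R * exp.ln (q 0 s))).
    rewrite exp.expR_sum rmorph_prod; apply: eq_bigr => s _.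
    by rewrite mxE exp.expRM_natl exp.lnK ?posrE ?q0 // rmorphXn.
  rewrite !qE; congr (toC (sequences.expR _)).
  apply/eqP; rewrite -subr_eq0 -sumrB; apply/eqP.
  transitivity ((map_mx (@exp.ln R) q *m (map_mx intr k)^T) 0 0).
    rewrite mxE; apply: eq_bigr => s _; rewrite !mxE kE rmorphB /=.
    by rewrite mulrBr ![exp.ln _ * _]mulrC.
  rewrite ql -mulmxA -(map_quasi_independence_mx intr).
  have -> : map_mx intr (quasi_independence_mx int S) *m (map_mx intr k)^T = 0 :> 'cV[R]__.
    by rewrite map_trmx -map_mxM -[X in X *m _]trmxK -trmx_mul kA trmx0 map_mx0.
  by rewrite mulmx0 mxE.
have := wT _ fV.
have pkn : \prod_s p 0 s ^+ kp s = \prod_s p 0 s ^+ kn s.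
  have := pV _ fV; rewrite mevalB !mevalX => /eqP; rewrite subr_eq0 => /eqP //.
set c := \prod_s _ ^+ kn s in pkn.
have c0 : c != 0 by apply/prodf_neq0 => s _; rewrite expf_neq0.
have der (d : 'X_{1..N}) s : ('X_[d] : {mpoly C[N]})^`M(s).@[fun i => p 0 i] =
    (d s)%:R * (\prod_i p 0 i ^+ d i) / p 0 s.
  rewrite mderivX mevalZ mevalX; have [->|ds] := eqVneq (d s) 0%N.
    by rewrite !mul0r.
  rewrite -mulrA; congr (_ * _).
  rewrite (bigD1 s) //= [in RHS](bigD1 s) //= !mnmE eqxx.
  rewrite mulrAC -[in RHS](prednK (n := d s)) ?lt0n // exprSr mulfK // subn1.
  congr (_ * _); apply: eq_bigr => i /negbTE ni.
  by rewrite mnmBE mnm1E eq_sym ni subn0.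
under eq_bigr => s _ do rewrite mderivB mevalB !der pkn -/c.
move=> H; apply: (mulfI c0); rewrite mulr0 -[RHS]H mulr_sumr.
apply: eq_bigr => s _; rewrite kE rmorphB /= -!pmulrn; field; exact: p0.
Qed.

Lemma rational_row_integral (N' : nat) (x : 'rV[rat]_N') :
  exists2 d : rat, d != 0 & exists k : 'rV[int]_N', map_mx intr k = d *: x.
Proof.
exists (\prod_s (denq (x 0 s))%:~R).
  by apply/prodf_neq0 => s _; rewrite intr_eq0 denq_neq0.
exists (\row_s (numq (x 0 s) * \prod_(s' | s' != s) denq (x 0 s'))).
apply/rowP => s; rewrite !mxE rmorphM rmorph_prod [in RHS](bigD1 s) //= [RHS]mulrAC.
by congr (_ * _); rewrite numqE mulrC.
Qed.

Lemma tangent_kernel (p w v : 'rV[C]_N) :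
  zariski_closure (complex_model (S := S)) p -> (forall s, p 0 s != 0) ->
  zariski_tangent (complex_model (S := S)) p w ->
  v *m (quasi_independence_mx C S)^T = 0 ->
  \sum_s v 0 s * (w 0 s / p 0 s) = 0.
Proof.
move=> pV p0 wT; rewrite -(map_quasi_independence_mx (ratr : rat -> C)) map_trmx.
move=> /sub_kermxP; rewrite -map_kermx => /submxP[D vD].
have := mulmx_ker (quasi_independence_mx rat S)^T.
move: (kermx _) vD => K vD KA.
have -> : \sum_s v 0 s * (w 0 s / p 0 s) = (v *m \col_s (w 0 s / p 0 s)) 0 0.
  by rewrite mxE; apply: eq_bigr => s _; rewrite mxE.
rewrite vD -mulmxA (_ : map_mx _ K *m _ = 0) ?mulmx0 ?mxE //.
apply/matrixP => r c; rewrite ord1 !mxE {c}.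
have [d d0 [k kE]] := rational_row_integral (row r K).
have Kr0 : row r K *m (quasi_independence_mx rat S)^T = 0.
  by rewrite -row_mul KA row0.
have kA : k *m (quasi_independence_mx int S)^T = 0.
  suff H : map_mx (intr : int -> rat) (k *m (quasi_independence_mx int S)^T) = 0.
    move: (k *m _) H => M /rowP H; apply/rowP => c.
    by have := H c; rewrite !mxE => /eqP; rewrite intr_eq0 => /eqP.
  rewrite map_mxM -map_trmx map_quasi_independence_mx kE.
  by rewrite -scalemxAl Kr0 scaler0.
have dC : (ratr d : C) != 0 by rewrite fmorph_eq0.
apply: (mulfI dC); rewrite mulr0 -[RHS](tangent_integer_kernel pV p0 wT kA).
rewrite mulr_sumr; apply: eq_bigr => s _; rewrite !mxE [LHS]mulrA; congr (_ * _).
have := congr1 (fun A : 'rV[rat]_N => ratr (A 0 s) : C) kE.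
by rewrite /= !mxE rmorphM /= ratr_int => ->.
Qed.

Lemma monomial_critical_point (x : 'I_m -> C) (y : 'I_n -> C) (u : 'rV[C]_N)
    (z : C) :
  let p := \row_s (x (cell s).1 * y (cell s).2) in
  (forall s, p 0 s != 0) -> \sum_s p 0 s = 1 ->
  (u - z *: p) *m (quasi_independence_mx C S)^T = 0 ->
  critical_point u p.
Proof.
move=> p p0 p1 upA.
have pV : zariski_closure (complex_model (S := S)) p.
  apply: monomial_zariski_closure.
  by rewrite -[RHS]p1; apply: eq_bigr => s _; rewrite mxE.
split=> // w wT.
have w0 : \sum_s w 0 s = 0.
  pose f : {mpoly C[N]} := \sum_s 'X_s - 1.
  have fV : vanishing (complex_model (S := S)) f.
    move=> _ [q [_ q1 _] ->]; rewrite mevalB meval1 raddf_sum /=.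
    under eq_bigr => s _ do rewrite mevalXU mxE.
    by rewrite -rmorph_sum q1 rmorph1 subrr.
  rewrite -[RHS](wT _ fV); apply: eq_bigr => s _.
  have dX i : ('X_i : {mpoly C[N]})^`M(s) = ((i == s)%:R)%:MP.
    rewrite mderivX mnm1E; case: eqVneq => [->|_]; last by rewrite scale0r mpolyC0.
    rewrite scale1r (_ : (U_(s) - U_(s))%MM = 0%MM) ?mpolyX0 ?mpolyC1 //.
    by apply/mnmP => i'; rewrite mnmBE subnn mnm0E.
  rewrite mderivB -mpolyC1 mderivC subr0 (linear_sum (mderiv s)) raddf_sum /=.
  rewrite (bigD1 s) //= dX eqxx mevalC big1 ?addr0 ?mul1r // => i /negbTE ni.
  by rewrite dX ni mevalC.
have := tangent_kernel pV p0 wT upA.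
under eq_bigr => s _ do rewrite mxE [X in _ + X]mxE [X in _ - X]mxE mulrBl.
rewrite sumrB => /eqP; rewrite subr_eq0 => /eqP uE.
transitivity (\sum_s u 0 s * (w 0 s / p 0 s)).
  by apply: eq_bigr => s _; rewrite mulrAC mulrA.
rewrite uE; transitivity (\sum_s z * w 0 s).
  apply: eq_bigr => s _; have := p0 s; rewrite mxE => ps; field; move: ps.
  by rewrite mulf_eq0 negb_or andbC.
by rewrite -mulr_sumr w0 mulr0.
Qed.

End CriticalPoints.

(** * ML-degree one excludes the one-chord hexagon *)

Section NoHexagon.

Variables (R : realType) (m n : nat) (S : {set 'I_m * 'I_n}).
Local Notation C := R[i].
Local Notation N := #|S|.
Local Notation vertex := ('I_m + 'I_n)%type.

Definition edge (a b : vertex) : bool :=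
  match a, b with
  | inl i, inr j | inr j, inl i => (i, j) \in S
  | _, _ => false
  end.

Definition is_row (a : vertex) : bool := if a is inl _ then true else false.

Lemma edge_sym : ssrbool.symmetric edge. Proof. by case=> i [j|j]. Qed.

Lemma edge_irr : irreflexive edge. Proof. by case. Qed.

Lemma edge_side a b : edge a b -> is_row a != is_row b.
Proof. by case: a b => i []. Qed.

Definition margin (F : nmodType) (u : 'I_N -> F) (a : vertex) : F :=
  match a with
  | inl i => \sum_(s | (cell s).1 == i) u s
  | inr j => \sum_(s | (cell s).2 == j) u s
  end.

Arguments margin : simpl never.

Definition edge_product (z : vertex -> C) (s : 'I_N) : C :=
  z (inl (cell s).1) * z (inr (cell s).2).

Lemma marginB (u v : 'I_N -> C) a :
  margin (fun s => u s - v s) a = margin u a - margin v a.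
Proof. by case: a => i; apply: sumrB. Qed.

Lemma margin_edge_product (z : vertex -> C) a :
  z a * nbr_sum edge [set: vertex] z a = margin (edge_product z) a.
Proof.
have allT (F : vertex -> C) :
    \sum_(l in [set: vertex]) F l = \sum_i F (inl i) + \sum_j F (inr j).
  rewrite (eq_bigl (fun=> true)) ?big_sumType // => l; exact: in_setT.
rewrite /nbr_sum allT /margin; case: a => i /=.
  rewrite big1 ?add0r => [|k _]; last by rewrite mul0r.
  rewrite mulr_sumr.
  rewrite -(big_enum_val_cond (A := mem S) (fun c => c.1 == i)
    (fun c => z (inl c.1) * z (inr c.2))) /=.
  rewrite (eq_bigl (fun c : 'I_m * 'I_n => (c.1 == i) && ((c.1, c.2) \in S))); last first.
    by move=> [c1 c2]; rewrite andbC.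
  rewrite -(pair_big_dep (fun c1 => c1 == i) (fun c1 c2 => (c1, c2) \in S)
    (fun c1 c2 => z (inl c1) * z (inr c2))) /= big_pred1_eq.
  rewrite [RHS]big_mkcond /=; apply: eq_bigr => j _.
  by case: ifP => _; rewrite ?mul1r ?mul0r ?mulr0.
rewrite addrC big1 ?add0r => [|k _]; last by rewrite mul0r.
rewrite mulr_sumr.
rewrite -(big_enum_val_cond (A := mem S) (fun c => c.2 == i)
  (fun c => z (inl c.1) * z (inr c.2))) /=.
rewrite (eq_bigl (fun c : 'I_m * 'I_n => ((c.1, c.2) \in S) && (c.2 == i))); last first.
  by move=> [c1 c2].
rewrite -(pair_big_dep xpredT (fun c1 c2 => ((c1, c2) \in S) && (c2 == i))
  (fun c1 c2 => z (inl c1) * z (inr c2))) /=.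
apply: eq_bigr => k _; rewrite big_andbC big_mkcondr big_pred1_eq /=.
by case: ifP => _; rewrite ?mul1r ?mul0r ?mulr0 // mulrC.
Qed.

Lemma margin_component (d : 'I_N -> C) (K : pred vertex) : closed edge K ->
  \sum_(i | K (inl i)) margin d (inl i) = \sum_(j | K (inr j)) margin d (inr j).
Proof.
move=> clK; rewrite /margin.
rewrite (exchange_big_dep xpredT) //= [RHS](exchange_big_dep xpredT) //=.
apply: eq_bigr => s _.
have -> : \sum_(i | K (inl i) && ((cell s).1 == i)) d s =
    \sum_(i | i == (cell s).1) (if K (inl i) then d s else 0).
  by rewrite -big_mkcondr; apply: eq_bigl => i; rewrite andbC eq_sym.
have -> : \sum_(j | K (inr j) && ((cell s).2 == j)) d s =
    \sum_(j | j == (cell s).2) (if K (inr j) then d s else 0).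
  by rewrite -big_mkcondr; apply: eq_bigl => j; rewrite andbC eq_sym.
rewrite !big_pred1_eq; congr (if _ then _ else _).
apply: (clK (inl (cell s).1) (inr (cell s).2)).
by rewrite /= -surjective_pairing; apply: enum_valP.
Qed.

Lemma margin_complex (t : 'I_N -> R) a :
  margin (fun s => (t s)%:C%C : C) a = (margin t a)%:C%C.
Proof. by case: a => i; rewrite /margin rmorph_sum. Qed.

Lemma margin_Re (P : 'I_N -> C) a :
  margin (fun s => complex.Re (P s)) a = complex.Re (margin P a).
Proof.
have ReD : {morph @complex.Re R : x y / x + y} by move=> [? ?] [? ?].
by case: a => i; rewrite /margin (big_morph _ ReD (erefl _)).
Qed.

Lemma margin_close (t u : 'I_N -> R) (eta : R) a :
  (forall s, `|t s - u s| <= eta) -> `|margin t a - margin u a| <= N%:R * eta.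
Proof.
move=> H; have eta0 (s : 'I_N) : 0 <= eta by apply: le_trans (normr_ge0 _) (H s).
have Hsum (P : pred 'I_N) : \sum_(s | P s) `|t s - u s| <= N%:R * eta.
  apply: (@le_trans _ _ (\sum_(s < N) eta)).
    rewrite big_mkcond; apply: ler_sum => s _; case: ifP => _ //; exact: eta0.
  by rewrite sumr_const card_ord mulr_natl.
by case: a => i; rewrite /margin -sumrB; apply: le_trans (ler_norm_sum _ _ _) (Hsum _).
Qed.

Lemma conjc_nbr_sum (z : vertex -> C) a :
  conjc (z a) * nbr_sum edge [set: vertex] (fun b => conjc (z b)) a =
  conjc (z a * nbr_sum edge [set: vertex] z a).
Proof.
rewrite rmorphM rmorph_sum; congr (_ * _); apply: eq_bigr => l _.
by rewrite rmorphM rmorph_nat.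
Qed.

Variable rt : vertex -> vertex.
Hypothesis rt_edge : forall a b, edge a b -> rt a = rt b.
Hypothesis rt_connect : forall a, connect edge a (rt a).

Lemma margin_eq0 (d : 'I_N -> C) :
  (forall a, rt a != a -> margin d a = 0) -> forall a, margin d a = 0.
Proof.
move=> H a; have [ra|/H//] := eqVneq (rt a) a.
pose K b := rt b == a.
have clK : closed edge K by move=> b c /rt_edge bc; rewrite /in_mem /= /K bc.
have off b : K b -> b != a -> margin d b = 0.
  by move=> /eqP Kb ba; apply: H; rewrite Kb eq_sym.
have Ka : K a by rewrite /K ra.
have := margin_component d clK; case: a ra @K {clK} off Ka => i ra K off Ka.
  have -> : \sum_(k | K (inl k)) margin d (inl k) = margin d (inl i).
    rewrite (bigD1 i Ka) /= big1 ?addr0 // => k /andP[Kk ki].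
    by apply: off => //; apply: contraNneq ki => -[->].
  by move=> ->; apply: big1 => j Kj; apply: off.
have -> : \sum_(k | K (inr k)) margin d (inr k) = margin d (inr i).
  rewrite (bigD1 i Ka) /= big1 ?addr0 // => k /andP[Kk ki].
  by apply: off => //; apply: contraNneq ki => -[->].
by move=> <-; apply: big1 => j Kj; apply: off.
Qed.

Lemma margin_critical_point (u : 'rV[C]_N) (z : vertex -> C) :
  (forall a, z a != 0) -> \sum_s u 0 s != 0 ->
  (forall a, rt a != a -> z a * nbr_sum edge [set: vertex] z a = margin (u 0) a) ->
  critical_point u (\row_s (edge_product z s / \sum_s' u 0 s')).
Proof.
move=> z0 u0 Hz; set t := \sum_s u 0 s.
pose d s := u 0 s - edge_product z s.
have d0 a : margin d a = 0.
  apply: margin_eq0 => {}a ra; rewrite marginB -margin_edge_product Hz //.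
  exact: subrr.
have sumd : \sum_s d s = 0.
  rewrite (partition_big (fun s => (cell s).1) xpredT) //=.
  by apply: big1 => i _; apply: (d0 (inl i)).
have sumz : \sum_s edge_product z s = t.
  by apply/esym/eqP; rewrite -subr_eq0 -sumrB; apply/eqP.
have -> : \row_s (edge_product z s / t) =
    \row_s (z (inl (cell s).1) / t * z (inr (cell s).2)).
  by apply/rowP => s; rewrite !mxE /edge_product mulrAC.
apply: (@monomial_critical_point _ _ _ _ (fun i => z (inl i) / t)
  (fun j => z (inr j)) _ t).
- by move=> s; rewrite mxE mulf_neq0 // mulf_neq0 // invr_eq0.
- under eq_bigr => s _ do rewrite mxE mulrAC.
  by rewrite -mulr_suml sumz divff.
apply/rowP => a; rewrite mxE [RHS]mxE.
have dE s : (u - t *: \row_s (z (inl (cell s).1) / t * z (inr (cell s).2))) 0 s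
    = d s.
  by rewrite !mxE /d /edge_product; congr (_ - _); field.
under eq_bigr => s _ do rewrite dE mxE.
case: (splitP a) => k ak.
  have -> : a = lshift n k by apply: val_inj.
  rewrite -[RHS](d0 (inl k)) /margin [RHS]big_mkcond; apply: eq_bigr => s _.
  rewrite col_mxEu !mxE inE; case: eqP => _; by rewrite ?mulr1 ?mulr0.
have -> : a = rshift m k by apply: val_inj.
rewrite -[RHS](d0 (inr k)) /margin [RHS]big_mkcond; apply: eq_bigr => s _.
rewrite col_mxEd !mxE inE; case: eqP => _; by rewrite ?mulr1 ?mulr0.
Qed.

End NoHexagon.

Lemma nonreal_solvable_hexagon_graph (R : realType) m n (S : {set 'I_m * 'I_n}) i k l j p q :
  (i, j) \in S -> (i, p) \in S -> (i, q) \in S -> (k, j) \in S ->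
  (k, p) \in S -> (l, j) \in S -> (l, q) \in S ->
  (k, q) \notin S -> (l, p) \notin S ->
  exists rt : 'I_m + 'I_n -> 'I_m + 'I_n,
    [/\ forall a b, edge S a b -> rt a = rt b,
        forall a, connect (edge S) a (rt a) &
        nonreal_solvable R (edge S) rt (inl k) (inr j) [set: 'I_m + 'I_n]].
Proof.
move=> Sij Sip Siq Skj Skp Slj Slq kq lp.
set vertex := ('I_m + 'I_n)%type.
pose e := edge S.
pose x1 : vertex := inl i; pose x2 : vertex := inl k; pose x3 : vertex := inl l.
pose y1 : vertex := inr j; pose y2 : vertex := inr p; pose y3 : vertex := inr q.
have huniq : uniq [:: x1; x2; x3; y1; y2; y3].
  have ik : i != k by apply: contraNneq kq => <-.
  have il : i != l by apply: contraNneq lp => <-.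
  have kl : k != l by apply: contraNneq kq => ->.
  have jp : j != p by apply: contraNneq lp => <-.
  have jq : j != q by apply: contraNneq kq => <-.
  have pq : p != q by apply: contraNneq kq => <-.
  have lE (a b : 'I_m) : ((inl a : vertex) == inl b) = (a == b).
    by apply/eqP/eqP => [[]|->].
  have rE (a b : 'I_n) : ((inr a : vertex) == inr b) = (a == b).
    by apply/eqP/eqP => [[]|->].
  have lrE (a : 'I_m) (b : 'I_n) : ((inl a : vertex) == inr b) = false by [].
  rewrite /x1 /x2 /x3 /y1 /y2 /y3 /= !in_cons !in_nil !(lE, rE, lrE).
  by rewrite !negb_or ik il kl jp jq pq.
pose rt a := if connect e y1 a then y1 else fingraph.root e a.
have csym : connect_sym e by apply/sym_connect_sym/edge_sym.
have rt_edge a b : edge S a b -> rt a = rt b.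
  move=> ab; have cab : connect e a b by apply: connect1.
  rewrite /rt (same_connect_r csym cab).
  by case: ifP => // _; apply/(fingraph.rootP csym).
have rt_connect a : connect (edge S) a (rt a).
  rewrite /rt; case: ifP => [|_]; first by rewrite csym.
  exact: connect_root.
have rtK a : rt (rt a) = rt a.
  rewrite /rt; case ca: (connect e y1 a); first by rewrite connect0.
  by rewrite -(same_connect_r csym (connect_root e a)) ca root_root.
have rty : rt y1 = y1 by rewrite /rt connect0.
have Hhex : nonreal_solvable R e rt x2 y1 [set a in [:: x1; x2; x3; y1; y2; y3]].
  apply: (nonreal_solvable_hexagon R (side := @is_row m n) (@edge_sym _ _ S)) => //=.
  - exact: edge_side.
  - by rewrite Sij Sip.
  - by rewrite Skj Skp.
  - by rewrite Slj lp.
exists rt; split=> //.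
apply: (nonreal_solvable_setT (@edge_sym _ _ S) (@edge_irr _ _ S) rt_edge
  rt_connect _ _ _ _ Hhex).
  - by rewrite inE !inE eqxx orbT.
  - by rewrite inE !inE eqxx !orbT.
  - exact: rtK.
  have e1 a : e y1 a -> rt a = y1 by move=> ya; rewrite -(rt_edge y1).
  have rx1 : rt x1 = y1 by apply: e1.
  have rx2 : rt x2 = y1 by apply: e1.
  have rx3 : rt x3 = y1 by apply: e1.
  have ry2 : rt y2 = y1 by rewrite -(rt_edge x1).
  have ry3 : rt y3 = y1 by rewrite -(rt_edge x1).
  move=> a; rewrite !inE; case/or4P=> [/eqP->|/eqP->|/eqP->|].
  - by rewrite rx1 eqxx !orbT.
  - by rewrite rx2 eqxx !orbT.
  - by rewrite rx3 eqxx !orbT.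
  by case/or3P=> /eqP->; rewrite ?rty ?ry2 ?ry3 eqxx !orbT.
Qed.

Lemma ML_degree_one_no_hexagon (R : realType) m n (S : {set 'I_m * 'I_n}) :
  has_ML_degree R S 1 -> forall i k l j p q,
  (i, j) \in S -> (i, p) \in S -> (i, q) \in S -> (k, j) \in S ->
  (k, p) \in S -> (l, j) \in S -> (l, q) \in S ->
  ((k, q) \in S) || ((l, p) \in S).
Proof.
move=> [g g0 Hg] i k l j p q Sij Sip Siq Skj Skp Slj Slq.
apply/negPn; rewrite negb_or; apply/negP => /andP[kq lp].
have [rt [rt_edge rt_connect [b0 [sigma [Hlip Heq Hn0 _ HIm]]]]] :=
  nonreal_solvable_hexagon_graph R Sij Sip Siq Skj Skp Slj Slq kq lp.
set C := R[i]; set x2 : 'I_m + 'I_n := inl k in HIm; set y1 : 'I_m + 'I_n := inr j in HIm.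
set c0 := complexify b0 in Hlip Heq Hn0 HIm.
have nz : near c0 (fun b => forall a, sigma a b != 0).
  by apply: near_all => a; apply: lipschitz_near_neq0 => //; apply: Hn0.
have nI : near c0 (fun b => complex.Im (sigma x2 b * sigma y1 b) != 0).
  apply: (lipschitz_near_nonreal (f := fun b => sigma x2 b * sigma y1 b)) => //.
  exact: lipschitzM.
have Hc0 := near_center Heq.
have [eps eps0 Heps] := near_and Heq (near_and nz nI).
pose u0 (s : 'I_#|S|) := complex.Re (edge_product (sigma^~ c0) s) : R.
have u0E a : rt a != a -> margin u0 a = b0 a.
  move=> ra; rewrite margin_Re -margin_edge_product Hc0 //.
pose eta := eps / (#|S|.+1)%:R.
have eta0 : 0 < eta by rewrite divr_gt0.
pose E s (z : C) := exists2 t : R, `|t - u0 s| <= eta & z = t%:C%C.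
have Einf s : infinite_pred (E s).
  apply: (@infinite_seq _ _ (fun r => (u0 s + eta / r.+1%:R)%:C%C)).
    move=> r r' /complexI /addrI /(mulfI (lt0r_neq0 eta0)) /invr_inj /eqP.
    by rewrite eqr_nat eqSS => /eqP.
  move=> r; exists (u0 s + eta / r.+1%:R) => //.
  have q0 : 0 <= eta / r.+1%:R by apply: divr_ge0; rewrite ?ler0n // ltW.
  rewrite addrAC subrr add0r ger0_norm //.
  by rewrite ler_pdivrMr ?ltr0n //; apply: ler_peMr; rewrite ?ler1n // ltW.
have X0 : \sum_s 'X_s != 0 :> {mpoly C[#|S|]}.
  pose s0 := enum_rank_in Sij (i, j).
  apply/eqP => /(congr1 (meval (fun s => (s == s0)%:R))).
  rewrite raddf_sum meval0 /= (bigD1 s0) //= mevalXU eqxx big1 ?addr0 => [/eqP|s].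
    by rewrite oner_eq0.
  by rewrite mevalXU => /negbTE ->.
have [v Ev] := mpoly_infinite_neq0 Einf (mulf_neq0 g0 X0).
rewrite mevalM mulf_eq0 negb_or raddf_sum /= => /andP[gv].
under eq_bigr => s _ do rewrite mevalXU.
move=> sv.
have /choice[t Ht] : forall s, exists t : R, `|t - u0 s| <= eta /\ v s = t%:C%C.
  by move=> s; have [t ? ?] := Ev s; exists t.
pose u : 'rV[C]_#|S| := \row_s v s.
have uE : forall s, u 0 s = v s by move=> s; rewrite mxE.
pose b a := if rt a == a then c0 a else margin v a.
have bt : cball c0 eps b.
  move=> a; rewrite /b; case: eqP => [_|/eqP ra].
    by rewrite subrr normc0 ltW.
  have -> : margin v a = (margin t a)%:C%C.
    rewrite -margin_complex; case: a {ra} => c; apply: eq_bigr => s _;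
      by rewrite (proj2 (Ht s)).
  rewrite /c0 /complexify -u0E // -rmorphB /= expr0n addr0 sqrtr_sqr.
  apply: (@le_trans _ _ (#|S|%:R * eta)).
    by apply: margin_close => s; case: (Ht s).
  rewrite /eta mulrA ler_pdivrMr ?ltr0n // [leLHS]mulrC.
  by apply: ler_wpM2l; [apply: ltW | rewrite ler_nat].
have [bE [bn0 bI]] := Heps b bt.
have b_real a : conjc (b a) = b a.
  rewrite /b; case: ifP => _; first by rewrite conjc_real.
  have -> : margin v a = (margin t a)%:C%C.
    rewrite -margin_complex; case: a => c; apply: eq_bigr => s _;
      by rewrite (proj2 (Ht s)).
  by rewrite conjc_real.
have crit1 : critical_point u (\row_s (edge_product (sigma^~ b) s / \sum_s' u 0 s')).
  apply: (margin_critical_point rt_edge) => //.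
    by under eq_bigr => s _ do rewrite uE.
  move=> a ra; rewrite bE ?in_setT // /b (negbTE ra).
  by case: a {ra} => c; apply: eq_bigr => s _; rewrite uE.
have crit2 : critical_point u
    (\row_s (edge_product (fun a => conjc (sigma a b)) s / \sum_s' u 0 s')).
  apply: (margin_critical_point rt_edge) => //.
  - by move=> a; rewrite conjc_eq0.
  - by under eq_bigr => s _ do rewrite uE.
  move=> a ra; rewrite conjc_nbr_sum bE ?in_setT // b_real /b (negbTE ra).
  by case: a {ra} => c; apply: eq_bigr => s _; rewrite uE.
have [|ps /andP[_ /eqP ps1] psP] := Hg u.
  by rewrite (meval_eq (v2 := v)).
case: ps ps1 psP => [//|p0 [|//]] _ psP.
have := (proj2 (psP _)) crit1; have := (proj2 (psP _)) crit2.
rewrite !inE => /eqP <- /eqP /rowP /(_ (enum_rank_in Skj (k, j))).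
have u_neq0 : \sum_s u 0 s != 0 by under eq_bigr => s _ do rewrite uE.
rewrite !mxE => /(mulIf (invr_neq0 u_neq0)).
rewrite /edge_product /cell enum_rankK_in //= -rmorphM => H.
move: bI; rewrite /x2 /y1; case: (_ * _) H => re im [imE] /= /eqP; apply.
by move: imE; lra.
Qed.

(** * Toric fiber products *)

Section HomogeneousToricIdeal.

Variables (K : fieldType) (k : nat) (T : finType) (f : 'I_k -> T).
Implicit Types (p q g : {mpoly K[k]}) (d : {ffun T -> nat}).

Lemma mcoeff_homogeneous_component d p u :
  (homogeneous_component f d p)@_u = if multidegree f u == d then p@_u else 0.
Proof.
rewrite /homogeneous_component raddf_sum /=.
under eq_bigr => v _ do rewrite mcoeffZ mcoeffX.
rewrite big_mkcond /=; have [up|up] := boolP (u \in msupp p).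
  rewrite (bigD1_seq u) ?msupp_uniq //= eqxx mulr1 big1 ?addr0 // => v /negbTE ->.
  by rewrite mulr0 if_same.
rewrite (memN_msupp_eq0 up) if_same big_seq big1 // => v vp.
case: (eqVneq v u) => [vu|_]; last by rewrite mulr0 if_same.
by rewrite vu (negbTE up) in vp.
Qed.

Lemma homogeneous_componentD d p q : homogeneous_component f d (p + q) =
  homogeneous_component f d p + homogeneous_component f d q.
Proof.
apply/mpolyP => u; rewrite mcoeffD !mcoeff_homogeneous_component mcoeffD.
by case: ifP => _; rewrite ?addr0.
Qed.

Lemma homogeneous_component0 d : homogeneous_component f d (0 : {mpoly K[k]}) = 0.
Proof.
by apply/mpolyP => u; rewrite mcoeff_homogeneous_component mcoeff0 if_same.
Qed.

Lemma homogeneous_componentZX d c u :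
  homogeneous_component f d (c *: 'X_[u] : {mpoly K[k]}) =
  if multidegree f u == d then c *: 'X_[u] else 0.
Proof.
apply/mpolyP => v; rewrite mcoeff_homogeneous_component mcoeffZ mcoeffX.
case: (eqVneq u v) => [->|uv].
  by case: ifP => _; rewrite ?mcoeff0 // mcoeffZ mcoeffX eqxx.
rewrite mulr0 if_same; case: ifP => _; rewrite ?mcoeff0 //.
by rewrite mcoeffZ mcoeffX (negbTE uv) mulr0.
Qed.

Lemma multidegreeD (u v : 'X_{1..k}) c :
  multidegree f (u + v)%MM c = (multidegree f u c + multidegree f v c)%N.
Proof. by rewrite !ffunE -big_split; apply: eq_bigr => i _; rewrite mnmDE. Qed.

Lemma homogeneous_component_binomial d q (u v : 'X_{1..k}) :
  multidegree f u = multidegree f v ->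
  exists q', homogeneous_component f d (q * ('X_[u] - 'X_[v])) =
             q' * ('X_[u] - 'X_[v]).
Proof.
move=> uv; rewrite {1}[q]mpolyE; elim: (msupp q) => [|w s [q' IH]].
  by exists 0; rewrite big_nil !mul0r homogeneous_component0.
have wuv : multidegree f (w + u)%MM = multidegree f (w + v)%MM.
  by apply/ffunP => c; rewrite !multidegreeD uv.
exists ((if multidegree f (w + u)%MM == d then q@_w *: 'X_[w] else 0) + q').
rewrite big_cons mulrDl homogeneous_componentD IH mulrDl; congr (_ + _).
rewrite mulrBr -!scalerAl -!mpolyXD -scaleNr homogeneous_componentD.
rewrite !homogeneous_componentZX -wuv; case: ifP => _; last by rewrite mul0r addr0.
by rewrite scaleNr mulrBr -!scalerAl -!mpolyXD.
Qed.

Lemma homogeneous_toric_ideal (a : nat) (X : 'M[int]_(a, k)) :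
  (forall w : 'cV[int]_k, X *m w = 0 ->
     forall c, \sum_(i | f i == c) w i 0 = 0) ->
  homogeneous_ideal f (toric_ideal (K := K) X).
Proof.
move=> kerX p d [s sX ->] {p}.
elim: s sX => [|[q g] s IHs] sX.
  by exists [::] => //; rewrite !big_nil homogeneous_component0.
have [|s' s'X s'E] := IHs.
  by move=> qg qgs; apply: sX; rewrite in_cons qgs orbT.
have [u [v [uvX gE]]] := sX (q, g) (mem_head _ _).
have uv : multidegree f u = multidegree f v.
  apply/ffunP => c; apply/eqP; rewrite !ffunE -eqz_nat -subr_eq0 !(rmorph_sum Posz).
  rewrite -sumrB; apply/eqP; rewrite -[RHS](kerX _ uvX c).
  by apply: eq_bigr => i _; rewrite mxE.
have [q' q'E] := homogeneous_component_binomial d q uv.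
exists ((q', g) :: s').
  move=> qg; rewrite in_cons => /predU1P[->|/s'X //]; exact: (sX (q, g) (mem_head _ _)).
by move: gE => /= gE; rewrite !big_cons homogeneous_componentD s'E /= gE q'E.
Qed.

End HomogeneousToricIdeal.

Lemma map_enum_val (T : finType) (A : {set T}) :
  [seq enum_val i | i <- enum 'I_#|A|] = enum A.
Proof.
have [->|/set0Pn[x0 _]] := eqVneq A set0.
  by rewrite enum_set0; apply: size0nil; rewrite size_map size_enum_ord cards0.
apply: (@eq_from_nth _ x0) => [|i]; rewrite size_map size_enum_ord.
  exact: cardE.
move=> iA'; rewrite (nth_map (Ordinal iA')) ?size_enum_ord // (enum_val_nth x0).
by rewrite nth_enum_ord.
Qed.

Definition subcolumns a k (Z : 'M[int]_(a, k)) (U : {set 'I_k}) :=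
  \matrix_(i < a, j < #|U|) Z i (enum_val j).

Lemma col_subcolumns a k (Z : 'M[int]_(a, k)) U j :
  col j (subcolumns Z U) = col (enum_val j) Z.
Proof. by apply/colP => i; rewrite !mxE. Qed.

Lemma subcolumns_sub_multiset a k (Z : 'M[int]_(a, k)) U :
  sub_multiset (columns (subcolumns Z U)) (columns Z).
Proof.
have -> : columns (subcolumns Z U) = [seq col s Z | s <- enum U].
  rewrite -map_enum_val -map_comp; apply: eq_map => j; exact: col_subcolumns.
move=> x; apply/leq_count_subseq/map_subseq; rewrite enumT.
by rewrite /enum_mem; apply: filter_subseq.
Qed.

Lemma homogeneous_subcolumns (K : fieldType) a k (Z : 'M[int]_(a, k)) (U : {set 'I_k})
    (L T : finType) (lab : 'I_k -> L) (f : 'I_#|U| -> T) :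
  (forall i j, (f i == f j) = (lab (enum_val i) == lab (enum_val j))) ->
  (forall w : 'cV[int]_k, Z *m w = 0 ->
     forall c, \sum_(s | lab s == c) w s 0 = 0) ->
  homogeneous_ideal f (toric_ideal (K := K) (subcolumns Z U)).
Proof.
move=> fE kerZ; apply: homogeneous_toric_ideal => w wZ c.
pose w' : 'cV[int]_k := \col_s \sum_(i | enum_val i == s) w i 0.
have sumE (F : 'I_k -> int) : \sum_s F s * w' s 0 = \sum_i F (enum_val i) * w i 0.
  rewrite [RHS](partition_big (fun i => enum_val i) xpredT) //=.
  apply: eq_bigr => s _; rewrite mxE mulr_sumr.
  by apply: eq_bigr => i /eqP ->.
have w'Z : Z *m w' = 0.
  apply/colP => r; rewrite -[RHS](congr1 (fun A : 'cV_a => A r 0) wZ) !mxE.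
  by rewrite sumE; apply: eq_bigr => i _; rewrite !mxE.
have [i0 /eqP fi0|nof] := pickP (fun i => f i == c); last by rewrite big_pred0.
rewrite -[RHS](kerZ w' w'Z (lab (enum_val i0))) [RHS]big_mkcond /=.
transitivity (\sum_s (lab s == lab (enum_val i0))%:R * w' s 0).
  rewrite sumE big_mkcond; apply: eq_bigr => i _; rewrite -fi0 fE.
  by case: ifP => _; rewrite ?mul1r ?mul0r.
by apply: eq_bigr => s _; case: ifP => _; rewrite ?mul1r ?mul0r.
Qed.

(* [rho s] and [kappa s] are the chosen representatives of the columns of
   [Z1] and [Z2] through which the column [s] of the stack is counted. *)
Lemma toric_fiber_product_of_representatives (K : fieldType) (k a b : nat)
    (L : finType) (Z1 : 'M[int]_(a, k)) (Z2 : 'M[int]_(b, k)) (lab : 'I_k -> L)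
    (rho kappa : 'I_k -> 'I_k) :
  (forall s, lab (rho s) = lab s) -> (forall s, lab (kappa s) = lab s) ->
  (forall s, rho (rho s) = rho s) -> (forall s, kappa (kappa s) = kappa s) ->
  (forall s, col (rho s) Z1 = col s Z1) ->
  (forall s, col (kappa s) Z2 = col s Z2) ->
  (forall s s', rho s = rho s' -> kappa s = kappa s' -> s = s') ->
  (forall u v, lab u = lab v -> exists s, rho s = rho u /\ kappa s = kappa v) ->
  (forall w : 'cV[int]_k, Z1 *m w = 0 ->
     forall c, \sum_(s | lab s == c) w s 0 = 0) ->
  (forall w : 'cV[int]_k, Z2 *m w = 0 ->
     forall c, \sum_(s | lab s == c) w s 0 = 0) ->
  exists (kx ky : nat) (X : 'M[int]_(a, kx)) (Y : 'M[int]_(b, ky)),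
    [/\ sub_multiset (columns X) (columns Z1),
        sub_multiset (columns Y) (columns Z2) &
        exists (T : finType) (f : 'I_kx -> T) (g : 'I_ky -> T),
          [/\ surj f, surj g &
              is_toric_fiber_product K X Y f g (col_mx Z1 Z2)]].
Proof.
move=> labr labk rhoK kapK rhoZ kapZ inj prod ker1 ker2.
pose U := [set s | rho s == s]; pose V := [set s | kappa s == s].
have rU s : rho s \in U by rewrite inE rhoK.
have kV s : kappa s \in V by rewrite inE kapK.
exists #|U|, #|V|, (subcolumns Z1 U), (subcolumns Z2 V).
split; [exact: subcolumns_sub_multiset | exact: subcolumns_sub_multiset |].
pose T : finType := {c : L | c \in codom lab}.
pose lab' s : T := Sub (lab s) (codom_f lab s).
have lab'E s s' : (lab' s == lab' s') = (lab s == lab s') by [].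
have lab'_surj (c : T) : exists s, lab' s = c.
  by have /codomP[s cs] := valP c; exists s; apply: val_inj.
exists T, (fun i => lab' (enum_val i)), (fun j => lab' (enum_val j)); split.
- move=> c; have [s <-] := lab'_surj c; exists (enum_rank_in (rU s) (rho s)).
  by apply/eqP; rewrite enum_rankK_in // lab'E labr.
- move=> c; have [s <-] := lab'_surj c; exists (enum_rank_in (kV s) (kappa s)).
  by apply/eqP; rewrite enum_rankK_in // lab'E labk.
split.
- by apply: homogeneous_subcolumns ker1.
- by apply: homogeneous_subcolumns ker2.
pose phi s := (enum_rank_in (rU s) (rho s), enum_rank_in (kV s) (kappa s)).
have phi1 s : enum_val (phi s).1 = rho s by rewrite enum_rankK_in.
have phi2 s : enum_val (phi s).2 = kappa s by rewrite enum_rankK_in.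
have -> : columns (col_mx Z1 Z2) =
    [seq col_mx (col ij.1 (subcolumns Z1 U)) (col ij.2 (subcolumns Z2 V)) |
       ij <- [seq phi s | s <- enum 'I_k]].
  rewrite -map_comp; apply: eq_map => s /=.
  by rewrite !col_subcolumns phi1 phi2 rhoZ kapZ col_col_mx.
apply: perm_map; apply: uniq_perm; rewrite ?enum_uniq //.
  rewrite map_inj_uniq ?enum_uniq // => s s' ss'.
  by apply: inj; rewrite -?phi1 -?phi2 ss'.
move=> [i j]; rewrite mem_enum inE /= lab'E; apply/mapP/eqP => [[s _ ijs]|lij].
  have [-> ->] : i = (phi s).1 /\ j = (phi s).2 by rewrite -ijs.
  by rewrite phi1 phi2 labr labk.
have [s [rs ks]] := prod _ _ lij; exists s; first by rewrite mem_enum.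
have := enum_valP i; have := enum_valP j; rewrite !inE => /eqP kj /eqP ri.
congr (_, _); apply: enum_val_inj; first by rewrite phi1 rs ri.
by rewrite phi2 ks kj.
Qed.

(** * Maximal cliques and levels *)

Section MaximalCliques.

Variables (m n : nat) (S : {set 'I_m * 'I_n}).
Hypothesis rows_occur : forall i : 'I_m, exists j : 'I_n, (i, j) \in S.
Hypothesis cols_occur : forall j : 'I_n, exists i : 'I_m, (i, j) \in S.
Hypothesis no_hexagon : forall i k l j p q,
  (i, j) \in S -> (i, p) \in S -> (i, q) \in S -> (k, j) \in S ->
  (k, p) \in S -> (l, j) \in S -> (l, q) \in S ->
  ((k, q) \in S) || ((l, p) \in S).

Implicit Types (D E F I : {set 'I_m * 'I_n}) (A : {set 'I_m}) (B : {set 'I_n}).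
Local Notation rows := clique_rows.
Local Notation cols := clique_cols.

Lemma rows_setX A B : B != set0 -> rows (finset.setX A B) = A.
Proof.
move=> /set0Pn[j jB]; apply/setP => i; apply/imsetP/idP => [[[i' j'] /=]|iA].
  by rewrite inE => /andP[? _] ->.
by exists (i, j); rewrite // inE /= iA.
Qed.

Lemma cols_setX A B : A != set0 -> cols (finset.setX A B) = B.
Proof.
move=> /set0Pn[i iA]; apply/setP => j; apply/imsetP/idP => [[[i' j'] /=]|jB].
  by rewrite inE => /andP[_ ?] ->.
by exists (i, j); rewrite // inE /= iA.
Qed.

Lemma Max_setX D : D \in Max S -> D = finset.setX (rows D) (cols D).
Proof. by rewrite inE => /maxsetP[/and3P[_ /eqP]]. Qed.

Lemma Max_sub D : D \in Max S -> D \subset S.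
Proof. by rewrite inE => /maxsetP[/and3P[]]. Qed.

Lemma in_Max D i j : D \in Max S -> ((i, j) \in D) = (i \in rows D) && (j \in cols D).
Proof. by move=> DM; rewrite {1}(Max_setX DM) in_setX. Qed.

Lemma Max_rows_neq0 D : D \in Max S -> rows D != set0.
Proof.
rewrite inE => /maxsetP[/and3P[/set0Pn[s sD] _ _] _].
by apply/set0Pn; exists s.1; apply: imset_f.
Qed.

Lemma Max_cols_neq0 D : D \in Max S -> cols D != set0.
Proof.
rewrite inE => /maxsetP[/and3P[/set0Pn[s sD] _ _] _].
by apply/set0Pn; exists s.2; apply: imset_f.
Qed.

Lemma is_clique_setX A B : A != set0 -> B != set0 ->
  finset.setX A B \subset S -> is_clique S (finset.setX A B).
Proof.
move=> A0 B0 sub; rewrite /is_clique rows_setX // cols_setX // eqxx sub !andbT.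
move: A0 B0 => /set0Pn[i iA] /set0Pn[j jB]; apply/set0Pn; exists (i, j).
by rewrite in_setX iA.
Qed.

Lemma Max_rowsP D i : D \in Max S ->
  reflect (forall j, j \in cols D -> (i, j) \in S) (i \in rows D).
Proof.
move=> DM; apply: (iffP idP) => [iD j jD|H].
  by apply: (subsetP (Max_sub DM)); rewrite in_Max // iD.
have : is_clique S (finset.setX (i |: rows D) (cols D)).
  apply: is_clique_setX; last 1 first.
  - apply/subsetP => -[i' j']; rewrite in_setX in_setU1 => /andP[/predU1P[-> //|i'D] j'D].
      exact: H.
    by apply: (subsetP (Max_sub DM)); rewrite in_Max // i'D.
  - by apply/set0Pn; exists i; rewrite setU11.
  - exact: Max_cols_neq0.
move: (DM); rewrite inE => /maxsetP[_ maxD] /maxD ED.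
have <- : rows (finset.setX (i |: rows D) (cols D)) = rows D.
  rewrite ED // {1}(Max_setX DM); apply/subsetP => -[i' j'].
  by rewrite !in_setX in_setU1 => /andP[-> ->]; rewrite orbT.
by rewrite rows_setX ?setU11 ?Max_cols_neq0.
Qed.

Lemma Max_colsP D j : D \in Max S ->
  reflect (forall i, i \in rows D -> (i, j) \in S) (j \in cols D).
Proof.
move=> DM; apply: (iffP idP) => [jD i iD|H].
  by apply: (subsetP (Max_sub DM)); rewrite in_Max // iD.
have : is_clique S (finset.setX (rows D) (j |: cols D)).
  apply: is_clique_setX; last 1 first.
  - apply/subsetP => -[i' j']; rewrite in_setX in_setU1 => /andP[i'D /predU1P[-> //|j'D]].
      exact: H.
    by apply: (subsetP (Max_sub DM)); rewrite in_Max // i'D.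
  - exact: Max_rows_neq0.
  - by apply/set0Pn; exists j; rewrite setU11.
move: (DM); rewrite inE => /maxsetP[_ maxD] /maxD ED.
have <- : cols (finset.setX (rows D) (j |: cols D)) = cols D.
  rewrite ED // {1}(Max_setX DM); apply/subsetP => -[i' j'].
  by rewrite !in_setX in_setU1 => /andP[-> ->]; rewrite orbT.
by rewrite cols_setX ?setU11 ?Max_rows_neq0.
Qed.

Lemma Max_intro A B : A != set0 -> B != set0 ->
  (forall i, (i \in A) <-> (forall j, j \in B -> (i, j) \in S)) ->
  (forall j, (j \in B) <-> (forall i, i \in A -> (i, j) \in S)) ->
  finset.setX A B \in Max S.
Proof.
move=> A0 B0 HA HB; rewrite inE; apply/maxsetP; split.
  apply: is_clique_setX => //; apply/subsetP => -[i j].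
  by rewrite in_setX => /andP[/HA iA /iA].
move=> E /and3P[_ /eqP EX ES] sub.
have in_E i j : ((i, j) \in E) = (i \in rows E) && (j \in cols E).
  by rewrite {1}EX in_setX.
have AE : A \subset rows E.
  apply/subsetP => i iA; have /set0Pn[j jB] := B0.
  by apply/imsetP; exists (i, j) => //; apply: (subsetP sub); rewrite in_setX iA.
have BE : B \subset cols E.
  apply/subsetP => j jB; have /set0Pn[i iA] := A0.
  by apply/imsetP; exists (i, j) => //; apply: (subsetP sub); rewrite in_setX iA.
apply/eqP; rewrite eqEsubset sub andbT; apply/subsetP => -[i j].
rewrite in_E => /andP[iE jE]; rewrite in_setX; apply/andP; split.
  apply/HA => j' /(subsetP BE) j'E; apply: (subsetP ES); by rewrite in_E iE.
by apply/HB => i' /(subsetP AE) i'E; apply: (subsetP ES); rewrite in_E i'E.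
Qed.

Lemma Max_cols_anti D E : D \in Max S -> E \in Max S ->
  (rows D \subset rows E) = (cols E \subset cols D).
Proof.
move=> DM EM; apply/subsetP/subsetP => [H j /(Max_colsP _ EM) jE|H i /(Max_rowsP _ DM) iD].
  by apply/(Max_colsP _ DM) => i /H /jE.
by apply/(Max_rowsP _ EM) => j /H /iD.
Qed.

Lemma Max_inj D E : D \in Max S -> E \in Max S ->
  rows D \subset rows E -> rows E \subset rows D -> D = E.
Proof.
move=> DM EM DE ED; rewrite (Max_setX DM) (Max_setX EM).
congr finset.setX; apply/eqP; rewrite eqEsubset; first by rewrite DE ED.
by rewrite -!Max_cols_anti // DE ED.
Qed.

Definition row_clique (i : 'I_m) : {set 'I_m * 'I_n} :=
  finset.setX [set i' | [forall j, ((i, j) \in S) ==> ((i', j) \in S)]]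
    [set j | (i, j) \in S].

Definition col_clique (j : 'I_n) : {set 'I_m * 'I_n} :=
  finset.setX [set i | (i, j) \in S]
    [set j' | [forall i, ((i, j) \in S) ==> ((i, j') \in S)]].

Lemma row_clique_Max i : row_clique i \in Max S.
Proof.
apply: Max_intro.
- by apply/set0Pn; exists i; rewrite inE; apply/forallP => j; apply/implyP.
- by have [j ij] := rows_occur i; apply/set0Pn; exists j; rewrite inE.
- move=> i'; rewrite inE; split => [/forallP H j|H].
    by rewrite inE => ij; apply: (implyP (H j)).
  by apply/forallP => j; apply/implyP => ij; apply: H; rewrite inE.
- move=> j; rewrite inE; split=> [ij i'|H].
    by rewrite inE => /forallP /(_ j) /implyP; apply.
  by apply: H; rewrite inE; apply/forallP => j'; apply/implyP.
Qed.

Lemma col_clique_Max j : col_clique j \in Max S.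
Proof.
apply: Max_intro.
- by have [i ij] := cols_occur j; apply/set0Pn; exists i; rewrite inE.
- by apply/set0Pn; exists j; rewrite inE; apply/forallP => i; apply/implyP.
- move=> i; rewrite inE; split=> [ij j'|H].
    by rewrite inE => /forallP /(_ i) /implyP; apply.
  by apply: H; rewrite inE; apply/forallP => i'; apply/implyP.
- move=> j'; rewrite inE; split => [/forallP H i|H].
    by rewrite inE => ij; apply: (implyP (H i)).
  by apply/forallP => i; apply/implyP => ij; apply: H; rewrite inE.
Qed.

Lemma cols_row_clique i : cols (row_clique i) = [set j | (i, j) \in S].
Proof.
rewrite cols_setX //; apply/set0Pn; exists i.
by rewrite inE; apply/forallP => j; apply/implyP.
Qed.

Lemma rows_col_clique j : rows (col_clique j) = [set i | (i, j) \in S].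
Proof.
rewrite rows_setX //; apply/set0Pn; exists j.
by rewrite inE; apply/forallP => i; apply/implyP.
Qed.

Lemma in_rows D i : D \in Max S ->
  (i \in rows D) = (rows (row_clique i) \subset rows D).
Proof.
move=> DM; rewrite Max_cols_anti ?row_clique_Max // cols_row_clique.
apply/(Max_rowsP _ DM)/subsetP => H j /H; by rewrite inE.
Qed.

Lemma in_cols D j : D \in Max S ->
  (j \in cols D) = (rows D \subset rows (col_clique j)).
Proof.
move=> DM; rewrite rows_col_clique.
apply/(Max_colsP _ DM)/subsetP => H i /H; by rewrite inE.
Qed.

Lemma in_cliqueE D i j : D \in Max S -> ((i, j) \in D) =
  (rows (row_clique i) \subset rows D) && (rows D \subset rows (col_clique j)).
Proof. by move=> DM; rewrite in_Max // in_rows // in_cols. Qed.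

Lemma row_le_col i j : (i, j) \in S ->
  rows (row_clique i) \subset rows (col_clique j).
Proof.
by move=> ij; rewrite -in_rows ?col_clique_Max // rows_col_clique inE.
Qed.

Lemma cliques_at_cell_comparable D E s : D \in Max S -> E \in Max S ->
  s \in D -> s \in E -> (rows D \subset rows E) || (rows E \subset rows D).
Proof.
case: s => i j DM EM; rewrite !in_Max // => /andP[iD jD] /andP[iE jE].
apply/negPn; rewrite negb_or; apply/negP => /andP[].
case/subsetPn => k kD kE; case/subsetPn => l lE lD.
have [q qE kq] : exists2 q, q \in cols E & (k, q) \notin S.
  have [/forallP H|/forallPn[q]] := boolP [forall q, (q \in cols E) ==> ((k, q) \in S)].
    by case/negP: kE; apply/(Max_rowsP _ EM) => q; apply/implyP.
  by rewrite negb_imply => /andP[? ?]; exists q.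
have [p pD lp] : exists2 p, p \in cols D & (l, p) \notin S.
  have [/forallP H|/forallPn[q' ]] := boolP [forall p, (p \in cols D) ==> ((l, p) \in S)].
    by case/negP: lD; apply/(Max_rowsP _ DM) => p; apply/implyP.
  by rewrite negb_imply => /andP[? ?]; exists q'.
have inS F i' j' : F \in Max S -> i' \in rows F -> j' \in cols F -> (i', j') \in S.
  by move=> FM i'F j'F; apply: (subsetP (Max_sub FM)); rewrite in_Max // i'F.
have := no_hexagon (inS D i j DM iD jD) (inS D i p DM iD pD) (inS E i q EM iE qE)
  (inS D k j DM kD jD) (inS D k p DM kD pD) (inS E l j EM lE jE) (inS E l q EM lE qE).
by rewrite (negbTE kq) (negbTE lp).
Qed.

Variable lev : {set 'I_m * 'I_n} -> nat.
Hypothesis lev_level : is_level S lev.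

Lemma cover_ex D E : D \in Max S -> E \in Max S -> clique_lt D E ->
  exists2 F, covers S F D & rows F \subset rows E.
Proof.
move=> DM EM DE.
pose P F := [&& F \in Max S, clique_lt D F & rows F \subset rows E].
have PE : P E by rewrite /P EM DE subxx.
case: (arg_minnP (fun F => #|rows F|) PE) => F /and3P[FM DF FE] minF.
exists F => //; apply/and4P; split=> //; apply/existsPn => G; apply/negP.
case/andP=> GM /andP[DG /andP[GF GFs]].
have : P G by rewrite /P GM DG (subset_trans GFs).
move/minF; apply/negP; rewrite -ltnNge; apply: proper_card.
rewrite properE GFs; apply/negP => FG.
by case/eqP: GF; apply: Max_inj.
Qed.

Lemma clique_lt_card D E : D \in Max S -> E \in Max S -> clique_lt D E ->
  (#|rows D| < #|rows E|)%N.
Proof.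
move=> DM EM /andP[nDE DE]; apply: proper_card; rewrite properE DE.
by apply/negP => ED; case/eqP: nDE; apply: Max_inj.
Qed.

Lemma level_between D E r : D \in Max S -> E \in Max S ->
  rows D \subset rows E -> (lev D <= r)%N -> (r <= lev E)%N ->
  exists F, [/\ F \in Max S, rows D \subset rows F, rows F \subset rows E & lev F = r].
Proof.
have [levS _ _] := lev_level.
have [N] := ubnP (r - lev D); elim: N D => // N IH D; rewrite ltnS => rN DM EM DE Dr rE.
have [rD|rD] := eqVneq (lev D) r; first by exists D.
have Dltr : (lev D < r)%N by rewrite ltn_neqAle rD.
have [|F FD FE] := cover_ex DM EM.
  by apply/andP; split=> //; apply: contraTneq rE => <-; rewrite -ltnNge.
have [_ FM /andP[_ DF] _] := and4P FD.
have lF := levS _ _ FD.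
have [||||||G [GM FG GE Gr]] := IH F; rewrite ?lF //.
  by apply: leq_trans rN; rewrite subnS prednK // subn_gt0.
by exists G; split=> //; apply: subset_trans FG.
Qed.

Lemma level_lt D E : D \in Max S -> E \in Max S -> clique_lt D E ->
  (lev D < lev E)%N.
Proof.
have [levS _ _] := lev_level.
have [N] := ubnP (#|rows E| - #|rows D|).
elim: N D => // N IH D; rewrite ltnS => cN DM EM DE.
have [F FD FE] := cover_ex DM EM DE.
have [_ FM DF _] := and4P FD.
have lF := levS _ _ FD.
have [<-|nFE] := eqVneq F E; first by rewrite lF.
have FltE : clique_lt F E by rewrite /clique_lt nFE.
apply: ltn_trans (IH F _ FM EM FltE); first by rewrite lF.
apply: leq_trans cN; have cDF := clique_lt_card DM FM DF.
have cFE := clique_lt_card FM EM FltE.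
by rewrite ltn_sub2l // (ltn_trans cDF).
Qed.

Lemma level_le D E : D \in Max S -> E \in Max S -> rows D \subset rows E ->
  (lev D <= lev E)%N.
Proof.
move=> DM EM DE; have [->//|nDE] := eqVneq D E.
by apply/ltnW/level_lt; rewrite // /clique_lt nDE.
Qed.

Lemma level_le_sub D E s : D \in Max S -> E \in Max S -> s \in D -> s \in E ->
  (lev D <= lev E)%N -> rows D \subset rows E.
Proof.
move=> DM EM sD sE DE; have [//|/=] := orP (cliques_at_cell_comparable DM EM sD sE).
move=> ED; have [->//|nED] := eqVneq E D.
have := level_lt EM DM; rewrite /clique_lt nED ED => /(_ isT).
by rewrite ltnNge DE.
Qed.

Lemma level_inj D E s : D \in Max S -> E \in Max S -> s \in D -> s \in E ->
  lev D = lev E -> D = E.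
Proof.
move=> DM EM sD sE DE.
by apply: Max_inj => //; apply: (@level_le_sub _ _ s) => //; rewrite DE.
Qed.

Definition row_level i := lev (row_clique i).
Definition col_level j := lev (col_clique j).

Lemma level_bounds D i j : D \in Max S -> (i, j) \in D ->
  (row_level i <= lev D <= col_level j)%N.
Proof.
move=> DM; rewrite in_cliqueE // => /andP[iD jD].
by rewrite !level_le ?row_clique_Max ?col_clique_Max.
Qed.

Lemma clique_at_level i j r : (i, j) \in S -> (row_level i <= r <= col_level j)%N ->
  exists2 D, D \in Max S & (i, j) \in D /\ lev D = r.
Proof.
move=> ij /andP[ir rj].
have [D [DM iD jD Dr]] := level_between (row_clique_Max i) (col_clique_Max j)
  (row_le_col ij) ir rj.
by exists D; rewrite // in_cliqueE // iD.
Qed.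

Lemma row_level_le_col i j : (i, j) \in S -> (row_level i <= col_level j)%N.
Proof.
by move=> /row_le_col; apply: level_le; rewrite ?row_clique_Max ?col_clique_Max.
Qed.

Lemma level_gt0 D : D \in Max S -> (0 < lev D)%N.
Proof. by case: lev_level => _ H _; apply: H. Qed.

Lemma in_Rset i r : (i \in Rset S lev r) = (r < row_level i)%N.
Proof.
elim: r => [|r IHr] /=; first by rewrite in_setT level_gt0 ?row_clique_Max.
rewrite in_setD IHr inE; apply/andP/idP => [[/existsPn nD ri]|ri].
  rewrite ltn_neqAle ri andbT; apply: contra (nD (row_clique i)) => /eqP ->.
  by rewrite row_clique_Max eqxx in_rows ?row_clique_Max ?subxx.
split; last exact: ltnW.
apply/existsPn => D; apply/negP => /andP[DM /andP[/eqP Dr iD]].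
have := level_le (row_clique_Max i) DM; rewrite -in_rows // iD Dr => /(_ isT).
by rewrite leqNgt ri.
Qed.

Lemma in_level_cols j r : (j \in level_cols S lev r) =
  [exists D in Max S, (lev D == r) && (j \in cols D)].
Proof. by rewrite inE. Qed.

Lemma in_Cset j r : (j \in Cset S lev r) = (col_level j <= r)%N.
Proof.
elim: r => [|r IHr] /=.
  by rewrite in_set0; apply/esym/negbTE; rewrite -ltnNge level_gt0 ?col_clique_Max.
rewrite in_setU IHr in_setD !in_level_cols [RHS]leq_eqVlt ltnS orbC; congr (_ || _).
apply/andP/eqP => [[/existsPn nD /existsP[D /andP[DM /andP[/eqP Dr jD]]]]|jr].
  have Dj : rows D \subset rows (col_clique j) by rewrite -in_cols.
  have := level_le DM (col_clique_Max j) Dj; rewrite Dr leq_eqVlt => /predU1P[//|rj].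
  have rD : (lev D <= r.+2)%N by rewrite Dr.
  have [F [FM _ Fj Fr]] := level_between DM (col_clique_Max j) Dj rD rj.
  by have := nD F; rewrite FM Fr eqxx in_cols // Fj.
split.
  apply/existsPn => D; apply/negP => /andP[DM /andP[/eqP Dr]]; rewrite in_cols //.
  by move=> /(level_le DM (col_clique_Max j)); rewrite Dr -/(col_level j) jr ltnn.
apply/existsP; exists (col_clique j); rewrite col_clique_Max -jr eqxx.
by rewrite in_cols ?col_clique_Max /=.
Qed.

Lemma in_XsetP r I : I \in Xset S lev r -> exists D E,
  [/\ D \in Max S, E \in Max S, lev D = r, lev E = r.+1 &
      rows D \subset rows E /\ I = D :&: E].
Proof.
rewrite inE => /andP[_ /existsP[D /existsP[E /and4P[ED /eqP Dr /eqP Er /eqP ->]]]].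
by have [DM EM /andP[_ DE] _] := and4P ED; exists D, E.
Qed.

Lemma Xset_intro r D E s : D \in Max S -> E \in Max S -> lev D = r -> lev E = r.+1 ->
  s \in D -> s \in E -> D :&: E \in Xset S lev r.
Proof.
move=> DM EM Dr Er sD sE.
have DE : rows D \subset rows E by apply: (level_le_sub DM EM sD sE); rewrite Dr Er.
have nDE : D != E by apply: contra_eq_neq Dr => ->; rewrite Er gtn_eqF.
have no_between F : F \in Max S -> rows D \subset rows F -> rows F \subset rows E ->
    F = D \/ F = E.
  move=> FM DF FE; have [->|nFD] := eqVneq F D; first by left.
  have [->|nFE] := eqVneq F E; first by right.
  have := level_lt DM FM; rewrite /clique_lt eq_sym nFD DF => /(_ isT).
  have := level_lt FM EM; rewrite /clique_lt nFE FE => /(_ isT).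
  by rewrite Dr Er ltnS => h1 h2; have := leq_trans h2 h1; rewrite ltnn.
have covED : covers S E D.
  apply/and4P; split=> //; first by rewrite /clique_lt nDE.
  apply/existsPn => F; apply/negP => /andP[FM /andP[/andP[nDF DF] /andP[nFE FE]]].
  have [FD|FE'] := no_between F FM DF FE; first by rewrite FD eqxx in nDF.
  by rewrite FE' eqxx in nFE.
rewrite inE; apply/andP; split; last first.
  by apply/existsP; exists D; apply/existsP; exists E; rewrite covED Dr Er !eqxx.
rewrite inE; apply/maxsetP; split.
  apply/andP; split; first by apply/set0Pn; exists s; rewrite inE sD.
  by apply/existsP; exists D; rewrite DM; apply/existsP; exists E; rewrite EM nDE /=.
move=> I /andP[I0 /existsP[F /andP[FM /existsP[G /andP[GM /andP[nFG /eqP IE]]]]]] sub.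
case: s sD sE => i0 j0; rewrite !in_Max // => /andP[i0D j0D] /andP[i0E j0E].
have cED : cols E \subset cols D by rewrite -Max_cols_anti.
have bet H : H \in Max S -> D :&: E \subset H -> H = D \/ H = E.
  move=> HM subH; apply: no_between => //.
    apply/subsetP => i iD; have : (i, j0) \in D :&: E.
      by rewrite inE !in_Max // iD j0D j0E (subsetP DE).
    by move=> /(subsetP subH); rewrite in_Max // => /andP[].
  rewrite Max_cols_anti //; apply/subsetP => j jE; have : (i0, j) \in D :&: E.
    by rewrite inE !in_Max // i0D i0E jE (subsetP cED).
  by move=> /(subsetP subH); rewrite in_Max // => /andP[].
have FDE : F = D \/ F = E.
  by apply: bet => //; apply: subset_trans sub _; rewrite IE subsetIl.
have GDE : G = D \/ G = E.
  by apply: bet => //; apply: subset_trans sub _; rewrite IE subsetIr.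
move: nFG; rewrite IE; case: FDE => ->; case: GDE => ->; rewrite ?eqxx // => _.
by rewrite finset.setIC.
Qed.

End MaximalCliques.

(** * Blocks *)

Section Blocks.

Variables (m n : nat) (S : {set 'I_m * 'I_n}).
Hypothesis rows_occur : forall i : 'I_m, exists j : 'I_n, (i, j) \in S.
Hypothesis cols_occur : forall j : 'I_n, exists i : 'I_m, (i, j) \in S.
Hypothesis no_hexagon : forall i k l j p q,
  (i, j) \in S -> (i, p) \in S -> (i, q) \in S -> (k, j) \in S ->
  (k, p) \in S -> (l, j) \in S -> (l, q) \in S ->
  ((k, q) \in S) || ((l, p) \in S).
Variable lev : {set 'I_m * 'I_n} -> nat.
Hypothesis lev_level : is_level S lev.

Local Notation cell := ('I_m * 'I_n)%type.
Local Notation rows := clique_rows.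
Local Notation cols := clique_cols.
Local Notation row_level := (row_level S lev).
Local Notation col_level := (col_level S lev).
Implicit Types (s : cell) (D E : {set cell}).

Definition blockset r (t : 'I_(block_size S lev r)) : {set cell} :=
  match split t with
  | inl a => enum_val a
  | inr b => match split b with
             | inl c => [set s | s.1 == enum_val c]
             | inr c => [set s | s.2 == enum_val c]
             end
  end.

Lemma blockE r t k : block S lev r t k = (enum_val k \in blockset t)%:R.
Proof.
rewrite /block /blockset mxE; case: (split t) => a; first by rewrite !mxE.
by rewrite mxE; case: (split a) => c; rewrite !mxE.
Qed.

Lemma blockset_inv r (t : 'I_(block_size S lev r)) s : s \in S -> s \in blockset t ->
  match split t with
  | inl a => exists D E, [/\ D \in Max S, E \in Max S, lev D = r, lev E = r.+1 &
      [/\ s \in D, s \in E & enum_val a = D :&: E]]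
  | inr b => match split b with
             | inl c => enum_val c = s.1 /\ (r < row_level s.1)%N
             | inr c => enum_val c = s.2 /\ (col_level s.2 <= r)%N
             end
  end.
Proof.
move=> sS; rewrite /blockset; case: (split t) => a.
  have [D [E [DM EM Dr Er [_ ->]]]] := in_XsetP (enum_valP a).
  by rewrite inE => /andP[sD sE]; exists D, E.
case: (split a) => c; rewrite inE => /eqP sc; have := enum_valP c; rewrite -sc.
  by rewrite in_Rset.
by rewrite in_Cset.
Qed.

Lemma blockset_ex r s : s \in S -> exists t : 'I_(block_size S lev r), s \in blockset t.
Proof.
case: s => i j ij; have [ri|ir] := ltnP r (row_level i).
  have iR : i \in Rset S lev r by rewrite in_Rset.
  exists (rshift _ (lshift _ (enum_rank_in iR i))).
  rewrite /blockset (unsplitK (inr _)) (unsplitK (inl _)) inE.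
  by rewrite enum_rankK_in.
have [jr|rj] := leqP (col_level j) r.
  have jC : j \in Cset S lev r by rewrite in_Cset.
  exists (rshift _ (rshift _ (enum_rank_in jC j))).
  rewrite /blockset (unsplitK (inr _)) (unsplitK (inr _)) inE.
  by rewrite enum_rankK_in.
have [|D DM [sD Dr]] := clique_at_level rows_occur cols_occur lev_level (r := r) ij.
  by rewrite ir ltnW.
have [|E EM [sE Er]] := clique_at_level rows_occur cols_occur lev_level (r := r.+1) ij.
  by rewrite rj ltnW.
have DEX := Xset_intro no_hexagon lev_level DM EM Dr Er sD sE.
exists (lshift _ (enum_rank_in DEX (D :&: E))).
by rewrite /blockset (unsplitK (inl _)) enum_rankK_in // inE sD.
Qed.

Lemma level_bounds_cell D s : D \in Max S -> s \in D ->
  (row_level s.1 <= lev D <= col_level s.2)%N.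
Proof. by case: s => i j; apply: level_bounds. Qed.

Lemma blockset_uniq r s (t t' : 'I_(block_size S lev r)) : s \in S ->
  s \in blockset t -> s \in blockset t' -> t = t'.
Proof.
move=> sS /(blockset_inv sS) it /(blockset_inv sS) it'.
apply: (can_inj splitK); move: it it'.
have rc : (row_level s.1 <= col_level s.2)%N.
  by case: s sS => i j sS; apply: row_level_le_col.
have Xno D E : D \in Max S -> E \in Max S -> lev D = r -> lev E = r.+1 ->
    s \in D -> s \in E -> (row_level s.1 <= r < col_level s.2)%N.
  move=> DM EM Dr Er sD sE.
  have /andP[h1 _] := level_bounds_cell DM sD.
  have /andP[_ h2] := level_bounds_cell EM sE.
  by rewrite -{1}Dr h1 -Er.
case: (split t) => [a [D [E [DM EM Dr Er [sD sE aE]]]]|b ib];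
  case: (split t') => [a' [D' [E' [DM' EM' Dr' Er' [sD' sE' aE']]]]|b' ib'].
- have DD : D = D' by apply: (level_inj no_hexagon lev_level DM DM' sD sD'); rewrite Dr.
  have EE : E = E' by apply: (level_inj no_hexagon lev_level EM EM' sE sE'); rewrite Er.
  by congr inl; apply: enum_val_inj; rewrite aE aE' DD EE.
- have /andP[h1 h2] := Xno D E DM EM Dr Er sD sE.
  by case: (split b') ib' => c [_ h];
    [have := leq_trans h h1 | have := leq_trans h2 h]; rewrite ltnn.
- have /andP[h1 h2] := Xno D' E' DM' EM' Dr' Er' sD' sE'.
  by case: (split b) ib => c [_ h];
    [have := leq_trans h h1 | have := leq_trans h2 h]; rewrite ltnn.
congr inr; apply: (can_inj splitK); move: ib ib'.
case: (split b) => c [cs h]; case: (split b') => c' [cs' h'].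
- by congr inl; apply: enum_val_inj; rewrite cs cs'.
- by have := leq_trans h (leq_trans rc h'); rewrite ltnn.
- by have := leq_trans h' (leq_trans rc h); rewrite ltnn.
- by congr inr; apply: enum_val_inj; rewrite cs cs'.
Qed.

Lemma block_class_sum (L : finType) (lab : cell -> L) r :
  (forall (t : 'I_(block_size S lev r)) s s', s \in S -> s' \in S ->
     s \in blockset t -> s' \in blockset t -> lab s = lab s') ->
  forall w : 'cV[int]_#|S|, block S lev r *m w = 0 ->
  forall c, \sum_(k | lab (enum_val k) == c) w k 0 = 0.
Proof.
move=> coarse w Bw c.
have ex (k : 'I_#|S|) : exists t : 'I_(block_size S lev r), enum_val k \in blockset t.
  exact: blockset_ex (enum_valP k).
pose tau k := xchoose (ex k).
have tauE k t : (tau k == t) = (enum_val k \in blockset t).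
  apply/eqP/idP => [<-|kt]; first exact: (xchooseP (ex k)).
  apply: (blockset_uniq (enum_valP k)) => //; exact: (xchooseP (ex k)).
rewrite (partition_big tau xpredT) //=; apply: big1 => t _.
have [/existsP[k0 /andP[/eqP k0c k0t]]|/existsPn no] :=
    boolP [exists k, (lab (enum_val k) == c) && (tau k == t)]; last first.
  by apply: big_pred0 => k; apply: negbTE (no k).
transitivity ((block S lev r *m w) t 0); last by rewrite Bw mxE.
rewrite [RHS]mxE big_mkcond; apply: eq_bigr => k _; rewrite blockE -tauE.
have [kt|] := boolP (tau k == t); last by rewrite andbF mul0r.
rewrite andbT mul1r (coarse t (enum_val k) (enum_val k0)) ?enum_valP // -?tauE //.
by rewrite k0c eqxx.
Qed.

Lemma col_block_eq r (k k' : 'I_#|S|) :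
  (forall t : 'I_(block_size S lev r),
     (enum_val k \in blockset t) = (enum_val k' \in blockset t)) ->
  col k (block S lev r) = col k' (block S lev r).
Proof. by move=> H; apply/colP => t; rewrite mxE [RHS]mxE !blockE H. Qed.

Lemma blockset_sym r (P : cell -> cell -> Prop) :
  (forall s s', P s s' -> P s' s) ->
  (forall s s', s \in S -> s' \in S -> P s s' ->
     forall t : 'I_(block_size S lev r), s \in blockset t -> s' \in blockset t) ->
  forall s s', s \in S -> s' \in S -> P s s' ->
  forall t : 'I_(block_size S lev r), (s \in blockset t) = (s' \in blockset t).
Proof.
by move=> Psym H s s' sS s'S Pss t; apply/idP/idP; apply: H => //; apply: Psym.
Qed.

Lemma blockset_high_row r s s' : s \in S -> s' \in S ->
  s.1 = s'.1 -> (r < row_level s.1)%N ->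
  forall t : 'I_(block_size S lev r), (s \in blockset t) = (s' \in blockset t).
Proof.
move=> sS s'S ss' rs.
apply: (@blockset_sym r (fun a b => a.1 = b.1 /\ (r < row_level a.1)%N)) => //.
  by move=> a b [ab h]; rewrite -ab.
move=> {sS s'S ss' rs}s {}s' sS s'S [ss' rs] t st; have := blockset_inv sS st.
rewrite /blockset; case: (split t) => [a [D [E [DM EM Dr Er [sD _ _]]]]|b].
  have /andP[h _] := level_bounds_cell DM sD.
  by have := leq_trans rs h; rewrite Dr ltnn.
case: (split b) => c [cs h]; first by rewrite inE cs ss'.
have rc : (row_level s.1 <= col_level s.2)%N.
  by case: s sS {st ss' rs cs h} => i j sS; apply: row_level_le_col.
by have := leq_trans rs (leq_trans rc h); rewrite ltnn.
Qed.

Lemma blockset_low_col r s s' : s \in S -> s' \in S ->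
  s.2 = s'.2 -> (col_level s.2 <= r)%N ->
  forall t : 'I_(block_size S lev r), (s \in blockset t) = (s' \in blockset t).
Proof.
move=> sS s'S ss' rs.
apply: (@blockset_sym r (fun a b => a.2 = b.2 /\ (col_level a.2 <= r)%N)) => //.
  by move=> a b [ab h]; rewrite -ab.
move=> {sS s'S ss' rs}s {}s' sS s'S [ss' rs] t st; have := blockset_inv sS st.
rewrite /blockset; case: (split t) => [a [D [E [DM EM Dr Er [_ sE _]]]]|b].
  have /andP[_ h] := level_bounds_cell EM sE.
  by have := leq_trans h rs; rewrite Er ltnn.
case: (split b) => c [cs h]; last by rewrite inE cs ss'.
have rc : (row_level s.1 <= col_level s.2)%N.
  by case: s sS {st ss' rs cs h} => i j sS; apply: row_level_le_col.
by have := leq_trans h (leq_trans rc rs); rewrite ltnn.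
Qed.

Lemma in_MaxE D s : D \in Max S -> (s \in D) = (s.1 \in rows D) && (s.2 \in cols D).
Proof. by case: s => i j; apply: in_Max. Qed.

Lemma blockset_clique_row r D s s' : D \in Max S -> (r < lev D)%N ->
  s \in D -> s' \in D -> s.1 = s'.1 ->
  forall t : 'I_(block_size S lev r), (s \in blockset t) = (s' \in blockset t).
Proof.
move=> DM rD sD s'D ss'; have inS := subsetP (Max_sub DM).
apply: (@blockset_sym r (fun a b => [/\ a \in D, b \in D & a.1 = b.1])); rewrite ?inS //.
  by move=> a b [? ? ?].
move=> {sD s'D ss'}s {}s' sS s'S [sD s'D ss'] t st; have := blockset_inv sS st.
rewrite /blockset; case: (split t) => [a [F [E [FM EM Fr Er [sF sE ->]]]]|b].
  have ED : rows E \subset rows D.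
    by apply: (level_le_sub no_hexagon lev_level EM DM sE sD); rewrite Er.
  have FE : rows F \subset rows E.
    by apply: (level_le_sub no_hexagon lev_level FM EM sF sE); rewrite Fr Er.
  move: sF sE s'D; rewrite inE !in_MaxE // ss' => /andP[-> _] /andP[-> _] /andP[_ s'D].
  have cDE : cols D \subset cols E by rewrite -(Max_cols_anti EM DM).
  have cEF : cols E \subset cols F by rewrite -(Max_cols_anti FM EM).
  have s'E := subsetP cDE _ s'D.
  by rewrite s'E (subsetP cEF).
case: (split b) => c [cs h]; first by rewrite inE cs ss'.
have /andP[_ h2] := level_bounds_cell DM sD.
by have := leq_trans rD (leq_trans h2 h); rewrite ltnn.
Qed.

Lemma blockset_clique_col r D s s' : D \in Max S -> (lev D <= r)%N ->
  s \in D -> s' \in D -> s.2 = s'.2 ->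
  forall t : 'I_(block_size S lev r), (s \in blockset t) = (s' \in blockset t).
Proof.
move=> DM Dr sD s'D ss'; have inS := subsetP (Max_sub DM).
apply: (@blockset_sym r (fun a b => [/\ a \in D, b \in D & a.2 = b.2])); rewrite ?inS //.
  by move=> a b [? ? ?].
move=> {sD s'D ss'}s {}s' sS s'S [sD s'D ss'] t st; have := blockset_inv sS st.
rewrite /blockset; case: (split t) => [a [F [E [FM EM Fr Er [sF sE ->]]]]|b].
  have DF : rows D \subset rows F.
    by apply: (level_le_sub no_hexagon lev_level DM FM sD sF); rewrite Fr.
  have FE : rows F \subset rows E.
    by apply: (level_le_sub no_hexagon lev_level FM EM sF sE); rewrite Fr Er.
  move: sF sE s'D; rewrite inE !in_MaxE // ss' => /andP[_ ->] /andP[_ ->] /andP[s'D _].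
  have s'F := subsetP DF _ s'D.
  by rewrite s'F (subsetP FE).
case: (split b) => c [cs h]; last by rewrite inE cs ss'.
have /andP[h2 _] := level_bounds_cell DM sD.
by have := leq_trans h (leq_trans h2 Dr); rewrite ltnn.
Qed.

End Blocks.

(** * Classes of the fiber product *)

Section Representatives.

Variables (m n : nat) (S : {set 'I_m * 'I_n}).
Hypothesis rows_occur : forall i : 'I_m, exists j : 'I_n, (i, j) \in S.
Hypothesis cols_occur : forall j : 'I_n, exists i : 'I_m, (i, j) \in S.
Hypothesis no_hexagon : forall i k l j p q,
  (i, j) \in S -> (i, p) \in S -> (i, q) \in S -> (k, j) \in S ->
  (k, p) \in S -> (l, j) \in S -> (l, q) \in S ->
  ((k, q) \in S) || ((l, p) \in S).
Variable lev : {set 'I_m * 'I_n} -> nat.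
Hypothesis lev_level : is_level S lev.
Variable r : nat.

Local Notation cell := ('I_m * 'I_n)%type.
Local Notation rows := clique_rows.
Local Notation cols := clique_cols.
Local Notation row_level := (row_level S lev).
Local Notation col_level := (col_level S lev).
Implicit Types (s : cell) (D E : {set cell}).

Definition fiber_class s : {set cell} + ('I_m + 'I_n) :=
  if [pick D in Max S | (lev D == r.+1) && (s \in D)] is Some D then inl D
  else if (r.+1 < row_level s.1)%N then inr (inl s.1) else inr (inr s.2).

Lemma fiber_class_clique D s : D \in Max S -> lev D = r.+1 -> s \in D ->
  fiber_class s = inl D.
Proof.
move=> DM Dr sD; rewrite /fiber_class; case: pickP => [E|/(_ D)].
  case/andP=> EM /andP[/eqP Er sE]; congr inl.
  by apply: (level_inj no_hexagon lev_level EM DM sE sD); rewrite Er.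
by rewrite /= DM Dr eqxx sD.
Qed.

Lemma fiber_class_row s : (r.+1 < row_level s.1)%N -> fiber_class s = inr (inl s.1).
Proof.
move=> rs; rewrite /fiber_class rs; case: pickP => // D /andP[DM /andP[/eqP Dr sD]].
have /andP[h _] := level_bounds_cell rows_occur cols_occur lev_level DM sD.
by have := leq_trans rs h; rewrite Dr ltnn.
Qed.

Lemma row_level_le_col_cell s : s \in S -> (row_level s.1 <= col_level s.2)%N.
Proof. by case: s => i j; apply: row_level_le_col. Qed.

Lemma fiber_class_col s : s \in S -> (col_level s.2 < r.+1)%N ->
  fiber_class s = inr (inr s.2).
Proof.
move=> sS sr; rewrite /fiber_class.
case: pickP => [D /andP[DM /andP[/eqP Dr sD]]|_].
  have /andP[_ h] := level_bounds_cell rows_occur cols_occur lev_level DM sD.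
  by rewrite Dr leqNgt sr in h.
by rewrite ltnNge (leq_trans (row_level_le_col_cell sS) (ltnW sr)).
Qed.

Variant fiber_class_spec s : {set cell} + ('I_m + 'I_n) -> Type :=
| FiberClique D of D \in Max S & lev D = r.+1 & s \in D : fiber_class_spec s (inl D)
| FiberRow of (r.+1 < row_level s.1)%N : fiber_class_spec s (inr (inl s.1))
| FiberCol of (col_level s.2 < r.+1)%N : fiber_class_spec s (inr (inr s.2)).

Lemma fiber_classP s : s \in S -> fiber_class_spec s (fiber_class s).
Proof.
move=> sS; have [rs|sr] := ltnP r.+1 (row_level s.1).
  by rewrite fiber_class_row //; apply: FiberRow.
have [sr'|rs] := ltnP (col_level s.2) r.+1.
  by rewrite fiber_class_col //; apply: FiberCol.
rewrite /fiber_class; case: pickP => [D /andP[DM /andP[/eqP Dr sD]]|noD].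
  exact: FiberClique.
exfalso; move: noD; case: s sS sr rs => i j sS sr rs noD.
have [|D DM [sD Dr]] := clique_at_level rows_occur cols_occur lev_level (r := r.+1) sS.
  by rewrite sr rs.
by have := noD D; rewrite /= DM sD Dr eqxx.
Qed.

Definition some_row D (i : 'I_m) : 'I_m := odflt i [pick i' in rows D].
Definition some_col D (j : 'I_n) : 'I_n := odflt j [pick j' in cols D].

Lemma some_rowE D i i' : D \in Max S -> some_row D i = some_row D i'.
Proof.
move=> /Max_rows_neq0/set0Pn[k kD]; rewrite /some_row; case: pickP => // /(_ k).
by rewrite kD.
Qed.

Lemma some_colE D j j' : D \in Max S -> some_col D j = some_col D j'.
Proof.
move=> /Max_cols_neq0/set0Pn[k kD]; rewrite /some_col; case: pickP => // /(_ k).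
by rewrite kD.
Qed.

Lemma some_row_in D i : D \in Max S -> some_row D i \in rows D.
Proof.
move=> /Max_rows_neq0/set0Pn[k kD]; rewrite /some_row; case: pickP => // /(_ k).
by rewrite kD.
Qed.

Lemma some_col_in D j : D \in Max S -> some_col D j \in cols D.
Proof.
move=> /Max_cols_neq0/set0Pn[k kD]; rewrite /some_col; case: pickP => // /(_ k).
by rewrite kD.
Qed.

Definition row_rep s : cell :=
  if fiber_class s is inl D then (s.1, some_col D s.2) else s.

Definition col_rep s : cell :=
  match fiber_class s with
  | inl D => (some_row D s.1, s.2)
  | inr (inl i) => (i, some_col (row_clique S i) s.2)
  | inr (inr j) => (some_row (col_clique S j) s.1, j)
  end.

Lemma row_rep_clique D s : D \in Max S -> s \in D -> (s.1, some_col D s.2) \in D.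
Proof. by move=> DM; rewrite !(in_MaxE _ DM) some_col_in // andbT => /andP[]. Qed.

Lemma col_rep_clique D s : D \in Max S -> s \in D -> (some_row D s.1, s.2) \in D.
Proof. by move=> DM; rewrite !(in_MaxE _ DM) some_row_in // => /andP[]. Qed.

Lemma col_rep_row i j : (i, some_col (row_clique S i) j) \in S.
Proof.
have := some_col_in j (row_clique_Max rows_occur i).
by rewrite cols_row_clique inE.
Qed.

Lemma col_rep_col i j : (some_row (col_clique S j) i, j) \in S.
Proof.
have := some_row_in i (col_clique_Max cols_occur j).
by rewrite rows_col_clique inE.
Qed.

Lemma row_rep_in s : s \in S -> row_rep s \in S.
Proof.
move=> sS; rewrite /row_rep; case: (fiber_classP sS) => // D DM _ sD.
by apply: (subsetP (Max_sub DM)); apply: row_rep_clique.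
Qed.

Lemma col_rep_in s : s \in S -> col_rep s \in S.
Proof.
move=> sS; rewrite /col_rep; case: (fiber_classP sS) => [D DM _ sD|_|_].
- by apply: (subsetP (Max_sub DM)); apply: col_rep_clique.
- exact: col_rep_row.
- exact: col_rep_col.
Qed.

Lemma fiber_class_row_rep s : s \in S -> fiber_class (row_rep s) = fiber_class s.
Proof.
move=> sS; case E: (fiber_class s) (fiber_classP sS) => [D|c]; last by rewrite /row_rep E E.
rewrite /row_rep E => H; inversion H; subst.
by apply: fiber_class_clique => //; apply: row_rep_clique.
Qed.

Lemma fiber_class_col_rep s : s \in S -> fiber_class (col_rep s) = fiber_class s.
Proof.
move=> sS; rewrite {1}/col_rep; case: (fiber_classP sS) => [D DM Dr sD|sr|sr].
- by apply: fiber_class_clique => //; apply: col_rep_clique.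
- by rewrite fiber_class_row.
- by rewrite fiber_class_col //; apply: col_rep_col.
Qed.

Lemma row_rep_idem s : s \in S -> row_rep (row_rep s) = row_rep s.
Proof.
move=> sS; rewrite {1}/row_rep fiber_class_row_rep // /row_rep.
by case: (fiber_classP sS) => [D DM Dr sD|sr|sr] //=; rewrite (some_colE _ s.2).
Qed.

Lemma col_rep_idem s : s \in S -> col_rep (col_rep s) = col_rep s.
Proof.
move=> sS; rewrite {1}/col_rep fiber_class_col_rep // /col_rep.
case: (fiber_classP sS) => [D DM Dr sD|sr|sr] /=.
- by rewrite (some_rowE _ s.1).
- by rewrite (some_colE _ s.2) // row_clique_Max.
- by rewrite (some_rowE _ s.1) // col_clique_Max.
Qed.

Lemma reps_inj s s' : s \in S -> s' \in S ->
  row_rep s = row_rep s' -> col_rep s = col_rep s' -> s = s'.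
Proof.
move=> sS s'S rr; have := fiber_class_row_rep sS.
rewrite rr fiber_class_row_rep // => cc; move: rr; rewrite /row_rep /col_rep cc.
case: (fiber_class s) => [D|c] //.
by case: s s' {sS s'S cc} => [i j] [i' j'] /(congr1 fst) /= -> /(congr1 snd) /= ->.
Qed.

Lemma reps_prod u v : u \in S -> v \in S -> fiber_class u = fiber_class v ->
  exists2 s, s \in S & row_rep s = row_rep u /\ col_rep s = col_rep v.
Proof.
move=> uS vS; rewrite /row_rep /col_rep.
case: (fiber_classP uS) => [D DM Dr uD|ur|ur] uv.
- have vD : v \in D.
    by case: (fiber_classP vS) uv => // D' _ _ vD' [->].
  have sD : (u.1, v.2) \in D.
    move: uD vD; rewrite !(in_MaxE _ DM) => /andP[uD _] /andP[_ vD].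
    by rewrite uD vD.
  exists (u.1, v.2); first exact: (subsetP (Max_sub DM)).
  rewrite (fiber_class_clique DM Dr sD) -uv /=.
  by rewrite (some_colE v.2 u.2) // (some_rowE u.1 v.1).
- exists u => //; rewrite -uv fiber_class_row //.
  by rewrite (some_colE u.2 v.2) // row_clique_Max.
- exists u => //; rewrite -uv fiber_class_col //.
  by rewrite (some_rowE u.1 v.1) // col_clique_Max.
Qed.

Lemma in_row_clique s : s \in S -> s \in row_clique S s.1.
Proof.
case: s => i j ij; have M := row_clique_Max rows_occur i.
rewrite (in_cliqueE rows_occur _ _ M) subxx.
exact: row_le_col.
Qed.

Lemma in_col_clique s : s \in S -> s \in col_clique S s.2.
Proof.
case: s => i j ij; have M := col_clique_Max cols_occur j.
rewrite (in_cliqueE rows_occur _ _ M) subxx andbT.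
exact: row_le_col.
Qed.

Lemma fiber_class_high_row s s' : s \in S -> s' \in S -> s.1 = s'.1 ->
  (r.+1 <= row_level s.1)%N -> fiber_class s = fiber_class s'.
Proof.
move=> sS s'S ss'; rewrite leq_eqVlt => /predU1P[rs|rs]; last first.
  by rewrite !fiber_class_row -?ss'.
have M := row_clique_Max rows_occur s.1.
rewrite (fiber_class_clique M (esym rs)) ?in_row_clique //.
by rewrite (fiber_class_clique M (esym rs)) // ss' in_row_clique.
Qed.

Lemma fiber_class_low_col s s' : s \in S -> s' \in S -> s.2 = s'.2 ->
  (col_level s.2 <= r.+1)%N -> fiber_class s = fiber_class s'.
Proof.
move=> sS s'S ss'; rewrite leq_eqVlt => /predU1P[rs|rs]; last first.
  by rewrite !fiber_class_col -?ss'.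
have M := col_clique_Max cols_occur s.2.
rewrite (fiber_class_clique M rs) ?in_col_clique //.
by rewrite (fiber_class_clique M rs) // ss' in_col_clique.
Qed.

Lemma fiber_class_block (t : 'I_(block_size S lev r)) s s' : s \in S -> s' \in S ->
  s \in blockset t -> s' \in blockset t -> fiber_class s = fiber_class s'.
Proof.
move=> sS s'S st s't; have := blockset_inv rows_occur cols_occur lev_level sS st.
have := blockset_inv rows_occur cols_occur lev_level s'S s't.
case: (split t) => [a [D' [E' [_ _ _ _ [s'D' s'E' aE']]]] [D [E [_ EM _ Er [_ sE aE]]]]|b].
  have : s' \in enum_val a by rewrite aE' inE s'D'.
  rewrite aE inE => /andP[_ s'E].
  by rewrite (fiber_class_clique EM Er sE) (fiber_class_clique EM Er s'E).
case: (split b) => c [cs' _] [cs h].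
  by apply: fiber_class_high_row; rewrite // -cs -cs'.
by apply: fiber_class_low_col => //; [rewrite -cs -cs' | apply: leqW].
Qed.

Lemma fiber_class_next_block (t : 'I_(block_size S lev r.+1)) s s' :
  s \in S -> s' \in S -> s \in blockset t -> s' \in blockset t ->
  fiber_class s = fiber_class s'.
Proof.
move=> sS s'S st s't; have := blockset_inv rows_occur cols_occur lev_level sS st.
have := blockset_inv rows_occur cols_occur lev_level s'S s't.
case: (split t) => [a [D' [E' [_ _ _ _ [s'D' s'E' aE']]]] [D [E [DM _ Dr _ [sD _ aE]]]]|b].
  have : s' \in enum_val a by rewrite aE' inE s'D'.
  rewrite aE inE => /andP[s'D _].
  by rewrite (fiber_class_clique DM Dr sD) (fiber_class_clique DM Dr s'D).
case: (split b) => c [cs' _] [cs h].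
  by apply: fiber_class_high_row => //; [rewrite -cs -cs' | apply: ltnW].
by apply: fiber_class_low_col; rewrite // -cs -cs'.
Qed.

Lemma blockset_row_rep q (t : 'I_(block_size S lev q)) s : (q <= r)%N ->
  s \in S -> (row_rep s \in blockset t) = (s \in blockset t).
Proof.
move=> qr sS; rewrite /row_rep; case: (fiber_classP sS) => // D DM Dr sD.
apply: (blockset_clique_row rows_occur cols_occur no_hexagon lev_level DM) => //.
- by rewrite Dr ltnS.
- exact: row_rep_clique.
Qed.

Lemma blockset_col_rep (t : 'I_(block_size S lev r.+1)) s :
  s \in S -> (col_rep s \in blockset t) = (s \in blockset t).
Proof.
move=> sS; rewrite /col_rep; case: (fiber_classP sS) => [D DM Dr sD|sr|sr].
- apply: (blockset_clique_col rows_occur cols_occur no_hexagon lev_level DM) => //.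
    by rewrite Dr.
  exact: col_rep_clique.
- by apply: blockset_high_row => //; apply: col_rep_row.
- by apply: blockset_low_col => //; [apply: col_rep_col | apply: ltnW].
Qed.

Lemma stack_ker q (w : 'cV[int]_#|S|) :
  stack (block S lev) q *m w = 0 -> block S lev q *m w = 0.
Proof.
by case: q => //= q; rewrite mul_col_mx -col_mx0 => /eq_col_mx[].
Qed.

Lemma stack_col_eq q (k k' : 'I_#|S|) :
  (forall q', (q' <= q)%N -> col k (block S lev q') = col k' (block S lev q')) ->
  col k (stack (block S lev) q) = col k' (stack (block S lev) q).
Proof.
elim: q => [|q IHq] H; first exact: H.
have Hq : col k (stack (block S lev) q) = col k' (stack (block S lev) q).
  by apply: IHq => q' q'q; apply: H; apply: leqW.
transitivity (col_mx (col k (stack (block S lev) q)) (col k (block S lev q.+1))).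
  exact: col_col_mx.
by rewrite Hq H // -col_col_mx.
Qed.

Lemma stack_toric_fiber_product (K : fieldType) :
  exists (kx ky : nat) (X : 'M[int]_(stack_size (block_size S lev) r, kx))
         (Y : 'M[int]_(block_size S lev r.+1, ky)),
    [/\ sub_multiset (columns X) (columns (stack (block S lev) r)),
        sub_multiset (columns Y) (columns (block S lev r.+1)) &
        exists (T : finType) (f : 'I_kx -> T) (g : 'I_ky -> T),
          [/\ surj f, surj g &
              is_toric_fiber_product K X Y f g (stack (block S lev) r.+1)]].
Proof.
pose rho (k : 'I_#|S|) := enum_rank_in (enum_valP k) (row_rep (enum_val k)).
pose kappa (k : 'I_#|S|) := enum_rank_in (enum_valP k) (col_rep (enum_val k)).
have rhoE k : enum_val (rho k) = row_rep (enum_val k).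
  by rewrite enum_rankK_in // row_rep_in // enum_valP.
have kapE k : enum_val (kappa k) = col_rep (enum_val k).
  by rewrite enum_rankK_in // col_rep_in // enum_valP.
apply: (@toric_fiber_product_of_representatives K _ _ _ _ _ _
  (fun k => fiber_class (enum_val k)) rho kappa).
- by move=> k; rewrite rhoE fiber_class_row_rep // enum_valP.
- by move=> k; rewrite kapE fiber_class_col_rep // enum_valP.
- by move=> k; apply: enum_val_inj; rewrite !rhoE row_rep_idem // enum_valP.
- by move=> k; apply: enum_val_inj; rewrite !kapE col_rep_idem // enum_valP.
- move=> k; apply: stack_col_eq => q qr; apply: col_block_eq => t.
  by rewrite rhoE blockset_row_rep // enum_valP.
- move=> k; apply: col_block_eq => t.
  by rewrite kapE blockset_col_rep // enum_valP.
- move=> k k' rr cc; apply: enum_val_inj; apply: reps_inj; rewrite ?enum_valP //.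
    by rewrite -!rhoE rr.
  by rewrite -!kapE cc.
- move=> k k' kk'; have [s sS [rs cs]] := reps_prod (enum_valP k) (enum_valP k') kk'.
  exists (enum_rank_in sS s); split; apply: enum_val_inj.
    by rewrite !rhoE enum_rankK_in.
  by rewrite !kapE enum_rankK_in.
- move=> w /stack_ker; apply: block_class_sum => // t s s'; exact: fiber_class_block.
- move=> w; apply: block_class_sum => // t s s'; exact: fiber_class_next_block.
Qed.

End Representatives.

Theorem theorem4p14 (R : realType) (m n : nat) (S : {set 'I_m * 'I_n})
    (rows_occur : forall i : 'I_m, exists j : 'I_n, (i, j) \in S)
    (cols_occur : forall j : 'I_n, exists i : 'I_m, (i, j) \in S)
    (ML_degree_one : has_ML_degree R S 1)
    (lev : {set 'I_m * 'I_n} -> nat)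
    (lev_level : is_level S lev) :
  iterated_toric_fiber_product R[i]%C (height S lev) (block S lev).
Proof.
move=> r _; apply: stack_toric_fiber_product => //.
exact: ML_degree_one_no_hexagon ML_degree_one.
Qed.
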